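(* Let $\lambda$ be a positive irrational real number and consider the following homogeneous cubic vector field on $\mathbb{R}^2$ parameterized by the scalar $\theta$: $$\begin{pmatrix}\dot{x} \\ \dot{y}\end{pmatrix} =\begin{pmatrix}\cos(\theta) & -\sin(\theta)\\ \sin(\theta)& \cos(\theta) \end{pmatrix} \begin{pmatrix}-2\lambda y(x^2+y^2)-2y(2x^2+y^2) \\ 4\lambda x(x^2+y^2)+2x(2x^2+y^2)\end{pmatrix}.$$ Then for any even degree $d$ of a candidate polynomial Lyapunov function, there exists a $\theta>0$ small enough such that this vector field is asymptotically stable but does not admit a polynomial Lyapunov function of degree $\leq d$.
   Context: A vector field $\dot{z}=f(z)$ on $\mathbb{R}^n$ with $f(0)=0$ is called asymptotically stable if its origin is asymptotically stable: (i) for every $\epsilon>0$ there exists $\delta=\delta(\epsilon)>0$ such that $\|z(0)\|<\delta$ implies $\|z(t)\|<\epsilon$ for all $t\geq 0$, and (ii) $\delta$ can be chosen such that $\|z(0)\|<\delta$ implies $\lim_{t\rightarrow\infty}z(t)=0$. (For homogeneous vector fields, local and global asymptotic stability are equivalent.) A polynomial Lyapunov function for $\dot{z}=f(z)$ is a polynomial $V:\mathbb{R}^n\to\mathbb{R}$ that is positive definite with negative definite derivative along trajectories, i.e., $V(z)>0$ for all $z\neq 0$, $V(0)=0$, and $\dot{V}(z)=\langle \nabla V(z),f(z)\rangle<0$ for all $z\neq 0$. *)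

(* Defs.v *)
From HB Require Import structures.
From mathcomp Require Import all_boot all_order all_algebra.
From mathcomp Require Import all_classical all_reals all_analysis.
(* The notations of mpoly clash with those of all_analysis. *)
From mathcomp Require Import -(notations) mpoly.

Set Implicit Arguments.
Unset Strict Implicit.
Unset Printing Implicit Defensive.

Import Order.TTheory GRing.Theory Num.Theory.
Import numFieldNormedType.Exports.

Local Open Scope classical_set_scope.
Local Open Scope ring_scope.

(* z solves z' = f(z) on [0, +oo[.  At t = 0 only continuity from the right is
   required, so the values of z at negative times are irrelevant; when f is
   continuous this yields the right derivative f (z 0) at 0 as well. *)
Definition solution (R : realType) (n : nat) (f : 'cV[R]_n -> 'cV[R]_n)
    (z : R -> 'cV[R]_n) : Prop :=
  {within [set t : R | 0 <= t], continuous z} /\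
  (forall t : R, 0 < t -> is_derive t (1 : R) z (f (z t))).

(* The norm `|.| on 'cV[R]_n is the max norm; the notion does not depend on the
   choice of the norm on R^n.  The second conjunct makes explicit that
   trajectories starting near the origin exist for all t >= 0, so that the last
   two conjuncts are not vacuous. *)
Definition asymptotically_stable (R : realType) (n : nat)
    (f : 'cV[R]_n -> 'cV[R]_n) : Prop :=
  [/\ f 0 = 0,
      exists2 delta : R, 0 < delta &
        forall z0 : 'cV[R]_n, `|z0| < delta ->
          exists2 z : R -> 'cV[R]_n, solution f z & z 0 = z0,
      forall eps : R, 0 < eps -> exists2 delta : R, 0 < delta &
        forall z : R -> 'cV[R]_n, solution f z -> `|z 0| < delta ->
          forall t : R, 0 <= t -> `|z t| < eps
    & exists2 delta : R, 0 < delta &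
        forall z : R -> 'cV[R]_n, solution f z -> `|z 0| < delta ->
          z t @[t --> +oo] --> (0 : 'cV[R]_n)].

Definition peval (R : realType) (n : nat) (p : mpoly.mpoly n R)
    (z : 'cV[R]_n) : R :=
  mpoly.meval (fun i => z i 0) p.

Definition gradient (R : realType) (n : nat) (V : mpoly.mpoly n R)
    (z : 'cV[R]_n) : 'cV[R]_n :=
  \col_i peval (mpoly.mderiv i V) z.

Definition inner (R : realType) (n : nat) (u v : 'cV[R]_n) : R :=
  \sum_(i < n) u i 0 * v i 0.

Definition polynomial_lyapunov (R : realType) (n : nat)
    (f : 'cV[R]_n -> 'cV[R]_n) (V : mpoly.mpoly n R) : Prop :=
  [/\ peval V 0 = 0,
      forall z : 'cV[R]_n, z != 0 -> 0 < peval V z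
    & forall z : 'cV[R]_n, z != 0 -> inner (gradient V z) (f z) < 0].

(* msize is one plus the total degree (and 0 for the zero polynomial). *)
Definition degree_le (R : realType) (n : nat) (V : mpoly.mpoly n R)
    (d : nat) : Prop :=
  (mpoly.msize V <= d.+1)%N.

Definition rotation (R : realType) (theta : R) : 'M[R]_2 :=
  \matrix_(i < 2, j < 2)
    nth 0 (nth [::] [:: [:: cos theta; - sin theta];
                        [:: sin theta;   cos theta]] i) j.

Definition cubic_field (R : realType) (lambda theta : R) (z : 'cV[R]_2) :
    'cV[R]_2 :=
  let x := z 0 0 in
  let y := z 1 0 in
  rotation theta *m
  \col_(i < 2)
    nth 0 [:: - 2 * lambda * y * (x ^+ 2 + y ^+ 2)
              - 2 * y * (2 * x ^+ 2 + y ^+ 2);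
              4 * lambda * x * (x ^+ 2 + y ^+ 2)
              + 2 * x * (2 * x ^+ 2 + y ^+ 2)] i.

(* Main.v *)
(* The unrotated field is tangent to the level curves of
   W = (x^2 + y^2) (2 x^2 + y^2)^lambda, and the rotation by theta makes it
   cross them inwards.

   Stability.  Replacing lambda by a close rational p / q turns a power of W
   into the polynomial (x^2 + y^2)^q (2 x^2 + y^2)^p, which still decreases
   along all trajectories.  Solutions exist because the field is a positive
   quadratic form times z rotated by pi / 2, plus a radial part: the orbit is a
   curve parametrized by the angle, and the angle solves a scalar autonomous
   equation.

   No Lyapunov function.  The lowest homogeneous part of a Lyapunov polynomial
   has even degree 2h > 0 and is nonincreasing along the field.  At y = 1 it is
   a univariate polynomial v, and v / W^(h / (1 + lambda)) has the same limit at
   both ends of the line, so a one-sided bound of order theta on its derivative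
   forces it to be constant up to O(theta).  A polynomial of bounded degree that
   is close enough to a multiple of W(x, 1)^(h / (1 + lambda)) cannot exist
   unless the latter is a polynomial, and then lambda is rational. *)
Require Import Defs.
From HB Require Import structures.
From mathcomp Require Import all_boot all_order all_algebra.
From mathcomp Require Import all_classical all_reals all_analysis.
From mathcomp Require Import -(notations) mpoly.
From mathcomp Require Import ring lra zify.

Set Implicit Arguments.
Unset Strict Implicit.
Unset Printing Implicit Defensive.

Import Order.TTheory GRing.Theory Num.Theory.
Import numFieldNormedType.Exports.

Local Open Scope ring_scope.

(** * Polynomial first integrals *)

Lemma poly_factor_out (F : fieldType) (a p : {poly F}) :
  (1 < size a)%N -> p != 0 ->
  exists m u, p = a ^+ m * u /\ ~~ (a %| u)%R.
Proof.
move=> a1; have [n] := ubnP (size p); elim: n p => // n IH p pn p0.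
have [ap|nap] := boolP (a %| p)%R; last by exists 0, p; rewrite expr0 mul1r.
have pE := divpK ap; set q := (p %/ a)%R in pE.
have q0 : q != 0 by apply: contraNneq p0 => q0; rewrite -pE q0 mul0r.
have a0 : a != 0 by rewrite -size_poly_gt0 (leq_trans _ a1).
have [|m [u [qE u_a]]] := IH q _ q0.
  have q1 : (0 < size q)%N by rewrite size_poly_gt0.
  by move: pn; rewrite -pE size_mul//; move: a1 q1;
    move: (size a) (size q) => i j; lia.
by exists m.+1, u; rewrite -pE qE exprSr -!mulrA [u * a]mulrC.
Qed.

(* Compare the multiplicities m of x^2+1: its residue in p'/p forces
   2m(1+lambda) = k. *)
Lemma no_polynomial_first_integral (R : realType) (lambda : R) (k : nat)
    (p : {poly R}) :
  0 < lambda -> irrational lambda -> (0 < k)%N -> p != 0 ->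
  (1 + lambda)%:P * (('X^2 + 1) * ('X^2 *+ 2 + 1) * p^`()) <>
  k%:R%:P * ('X * ('X^2 *+ 2 + 1 + (lambda *+ 2)%:P * ('X^2 + 1)) * p).
Proof.
move=> l0 lirr k0 p0 E.
pose A : {poly R} := 'X^2 + 1.
have sA : size A = 3.
  by rewrite /A -[1]polyC1 size_polyDl ?size_polyXn// size_polyC oner_eq0.
have [|m [u [pE uA]]] := @poly_factor_out _ A p _ p0; first by rewrite sA.
have A0 : A != 0 by rewrite -size_poly_gt0 sA.
(* Equality would give [lambda = k / (2 * m) - 1], a rational number. *)
have [mk|] := eqVneq ((m%:R *+ 2) * (1 + lambda)) k%:R.
  apply: lirr; exists ((k%:R / (m%:R *+ 2)) - 1) => //.
  have m0 : m%:R != 0 :> R.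
    by apply: contraTneq k0 => m0; move/eqP: mk;
      rewrite m0 mul0rn mul0r eq_sym pnatr_eq0 => /eqP ->.
  by rewrite rmorphB fmorph_div/= !rmorphMn/= rmorph1 -mk; field.
rewrite -subr_eq0 => mk.
have dA : A^`() = 'X *+ 2 by rewrite /A derivD derivXn derivC addr0 expr1.
(* Since [2 x^2 + 1 = 2 A - 1], every other term carries one more factor [A]. As [A] is coprime to
   ['X], it would then divide [u]. *)
have E1 : A ^+ m * (('X * u) * ((m%:R *+ 2) * (1 + lambda) - k%:R)%:P) =
   A ^+ m * (A * (('X * u)*+ 2 * ((m%:R *+ 2) * (1 + lambda) - k%:R)%:P + (1 + lambda)%:P * (A*+2 - 1) * u^`() - k%:R%:P * 'X * (lambda *+ 2)%:P * u)).
  move: E; rewrite pE -/A derivM.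
  have -> : ('X^2 *+ 2 + 1 : {poly R}) = A *+ 2 - 1 by rewrite /A; ring.
  case: m {pE mk} => [|m].
    rewrite expr0 derivC !polyCB !polyCD !polyCM !polyCMn polyC1 => E.
    by move: E; set L := (X in X = _ -> _) => E; apply: (addIr L);
      rewrite [in RHS]E /L; ring.
  rewrite deriv_exp dA /= !polyCB !polyCM !polyCD !polyCMn polyC1 exprS => E.
  by move: E; set L := (X in X = _ -> _) => E; apply: (addIr L);
    rewrite [in RHS]E /L; ring.
have /(mulfI (expf_neq0 m A0)) E2 := E1.
have : (A %| 'X * u)%R.
  rewrite -(@dvdpZr _ ((m%:R *+ 2) * (1 + lambda) - k%:R))// -mul_polyC mulrC E2.
  exact: dvdp_mulr.
rewrite Gauss_dvdpr; first by rewrite (negbTE uA).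
rewrite -['X]subr0 -[0]polyC0 coprimep_XsubC.
by rewrite /root !hornerE.
Qed.

(** * Lowest homogeneous part of a Lyapunov polynomial *)

Lemma horner_inj (R : numDomainType) (p q : {poly R}) :
  (forall x, p.[x] = q.[x]) -> p = q.
Proof.
move=> pq; apply/eqP; rewrite -subr_eq0; set r := p - q.
apply/eqP/(@roots_geq_poly_eq0 _ _ [seq i%:R | i <- iota 0 (size r)]).
- by apply/allP => _ /mapP[i _ ->]; rewrite /root !hornerE pq subrr.
- by rewrite map_inj_uniq ?iota_uniq// => i j /eqP; rewrite eqr_nat => /eqP.
- by rewrite size_map size_iota.
Qed.

(** Divided by [s ^+ k], the sum is a polynomial in [s] with constant term [c k]; a negative value
    at 0 would persist for small positive [s]. *)
Lemma lowest_coef_ge0 (R : realType) (n k : nat) (c : nat -> R) :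
  (forall j, (j < k)%N -> c j = 0) -> (k < n)%N ->
  (forall s, 0 < s -> 0 <= \sum_(j < n) s ^+ j * c j) -> 0 <= c k.
Proof.
move=> c0 kn c_ge0; rewrite leNgt; apply/negP => ck.
pose p := \poly_(j < n - k) c (k + j)%N.
have p0 : p.[0] = c k.
  by rewrite horner_coef0 coef_poly subn_gt0 kn addn0.
have pE s : \sum_(j < n) s ^+ j * c j = s ^+ k * p.[s].
  rewrite horner_poly mulr_sumr -(subnKC (ltnW kn)) big_split_ord/=.
  rewrite big1 ?add0r; last by move=> i _; rewrite c0 ?mulr0.
  rewrite addKn; apply: eq_bigr => i _; rewrite exprD; ring.
have : \forall s \near (0 : R), p.[s] < 0.
  have := @continuous_horner R p 0.
  by move=> /(@cvgr_lt _ _ _ _ _ _); apply; rewrite p0.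
case=> e /= e0 /(_ (e / 2));
  rewrite /ball_ /= sub0r normrN gtr0_norm ?divr_gt0//.
rewrite ltr_pdivrMr// ltr_pMr// ltr1n => /(_ isT); apply/negP; rewrite -leNgt.
have := c_ge0 (e / 2); rewrite pE divr_gt0// pmulr_rge0 ?exprn_gt0 ?divr_gt0//.
by apply.
Qed.

Section planar_forms.
Variable R : realType.
Implicit Types (V : mpoly.mpoly 2 R) (x s : R).

Definition point (x y : R) : 'cV[R]_2 := \col_(i < 2) nth 0 [:: x; y] i.

(* The homogeneous component of degree j of V, dehomogenized at y = 1. *)
Definition slice V (j : nat) : {poly R} :=
  \sum_(m <- mpoly.msupp V | mpoly.mdeg m == j)
     mpoly.mcoeff m V *: 'X^(m ord0).

Lemma sum_by_degree V d (F : mpoly.multinom 2 -> R) : degree_le V d ->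
  \sum_(m <- mpoly.msupp V) F m =
  \sum_(j < d.+1) \sum_(m <- mpoly.msupp V | mpoly.mdeg m == j) F m.
Proof.
move=> Vd; rewrite (exchange_big_dep xpredT)//=.
rewrite big_seq [RHS]big_seq; apply: eq_bigr => m mV.
have md : (mpoly.mdeg m < d.+1)%N := leq_trans (mpoly.msize_mdeg_lt mV) Vd.
by rewrite (big_pred1 (Ordinal md))// => i; rewrite /= eq_sym -val_eqE.
Qed.

Lemma mdeg2 (m : mpoly.multinom 2) : mpoly.mdeg m = (m ord0 + m ord_max)%N.
Proof.
rewrite mpoly.mdegE big_ord_recl big_ord1; congr (_ + m _)%N.
exact: val_inj.
Qed.

Lemma peval_slice V d x s : degree_le V d ->
  peval V (point (s * x) s) = \sum_(j < d.+1) s ^+ j * (slice V j).[x].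
Proof.
move=> Vd; rewrite /peval mpoly.mevalE (sum_by_degree _ Vd).
apply: eq_bigr => j _; rewrite /slice horner_sum mulr_sumr.
apply: eq_bigr => m /eqP <-;
  rewrite mdeg2 big_ord_recl big_ord1 !mxE/= !hornerE.
rewrite (_ : lift _ _ = ord_max) ?exprMn ?exprD; last exact: val_inj.
by rewrite /=; ring.
Qed.

Lemma peval_mderiv V i z : peval (mpoly.mderiv i V) z =
  \sum_(m <- mpoly.msupp V)
     (m i)%:R * (mpoly.mcoeff m V *
        \prod_(l < 2) z l 0 ^+ (m l - (i == l))%N).
Proof.
rewrite /peval /mpoly.mderiv rmorph_sum/=; apply: eq_bigr => m _.
by rewrite mpoly.mevalZ mpoly.mevalX mulrA; congr (_ * _);
  apply: eq_bigr => l _; rewrite mpoly.mnmBE mpoly.mnm1E.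
Qed.

(** The factor [s] restores the degree lost by differentiation, which avoids the exponent [j - 1] at
    [j = 0]. *)
Lemma gradient_slice0 V d x s : degree_le V d ->
  s * gradient V (point (s * x) s) ord0 0 =
  \sum_(j < d.+1) s ^+ j * (slice V j)^`().[x].
Proof.
move=> Vd; rewrite mxE peval_mderiv mulr_sumr (sum_by_degree _ Vd).
apply: eq_bigr => j _; rewrite /slice raddf_sum/= horner_sum mulr_sumr.
apply: eq_bigr => m /eqP <-; rewrite mdeg2 big_ord_recl big_ord1 !mxE/=.
rewrite (_ : lift _ _ = ord_max) ?subn0; last exact: val_inj.
rewrite derivZ derivXn -(scaler_nat _ 'X^_) !hornerE /=.
case: (m ord0) => [|a]; first by rewrite /= !(mul0r, mulr0).
rewrite subn1 /= exprMn exprD exprS /=; move: (a.+1%:R) => k; ring.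
Qed.

(** Euler's identity for a form of degree [j] gives the partial derivative in y from the one in
    x. *)
Lemma gradient_slice1 V d x s : degree_le V d ->
  s * gradient V (point (s * x) s) ord_max 0 =
  \sum_(j < d.+1) s ^+ j *
     (j%:R * (slice V j).[x] - x * (slice V j)^`().[x]).
Proof.
move=> Vd; rewrite mxE peval_mderiv mulr_sumr (sum_by_degree _ Vd).
apply: eq_bigr => j _; rewrite /slice raddf_sum/= !horner_sum !mulr_sumr -sumrB.
rewrite mulr_sumr.
apply: eq_bigr => m /eqP <-; rewrite mdeg2 big_ord_recl big_ord1 !mxE/=.
rewrite (_ : lift _ _ = ord_max) ?subn0; last exact: val_inj.
rewrite derivZ derivXn -(scaler_nat _ 'X^_) !hornerE natrD.
rewrite /=; have -> : x * mpoly.mcoeff m V * (m ord0)%:R * x ^+ (m ord0).-1 =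
  (m ord0)%:R * (mpoly.mcoeff m V * x ^+ m ord0).
  case: (m ord0) => [|a]; first by rewrite /= !(mul0r, mulr0).
  by rewrite exprS /=; ring.
case: (m ord_max) => [|b].
  by rewrite addn0 !(mulr0, mul0r); move: ((m ord0)%:R) => l; ring.
rewrite subn1 /= exprMn exprD exprS /=; move: (b.+1%:R) ((m ord0)%:R) => k l;
  ring.
Qed.

Lemma slice_size V j : (size (slice V j) <= j.+1)%N.
Proof.
apply: (leq_trans (size_sum _ _ _)); apply/bigmax_leqP_seq => m _ /eqP <-.
by rewrite (leq_trans (size_scale_leq _ _))// size_polyXn mdeg2 ltnS leq_addr.
Qed.

Lemma point_eq0 x y : (point x y == 0) = (x == 0) && (y == 0).
Proof.
apply/eqP/andP => [E|[/eqP -> /eqP ->]].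
  have := congr1 (fun M : 'cV_2 => M ord0 0) E.
  have := congr1 (fun M : 'cV_2 => M ord_max 0) E.
  by rewrite !mxE/= => -> ->.
by apply/matrixP => -[[|[|//]] i] j; rewrite !mxE.
Qed.

(** Along the ray through [(x, 1)], the signs of [V] and of its derivative pass to the lowest
    nonzero term as the ray parameter tends to 0; strictness is lost in this limit. By Euler's
    identity the last clause is the derivative along [f], at [(x, 1)], of the lowest form. *)
Lemma lyapunov_lowest_form (f : 'cV[R]_2 -> 'cV[R]_2) V d :
  (forall s z, f (s *: z) = s ^+ 3 *: f z) ->
  degree_le V d -> polynomial_lyapunov f V ->
  exists h (v : {poly R}),
    [/\ (0 < h)%N, (h.*2 <= d)%N, v != 0, (size v <= h.*2.+1)%N &
      forall x, f (point x 1) ord0 0 * v^`().[x] +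
        f (point x 1) ord_max 0 * (h.*2%:R * v.[x] - x * v^`().[x]) <= 0].
Proof.
move=> fZ Vd [V0 Vpos Vneg].
have Vge0 x s : s != 0 -> 0 < \sum_(j < d.+1) s ^+ j * (slice V j).[x].
  by move=> s0; rewrite -peval_slice// Vpos// point_eq0 negb_and s0 orbT.
have ex_k : exists k, (k < d.+1)%N && (slice V k != 0).
  apply: contrapT => nk; have := Vge0 0 1 (oner_neq0 _);
    rewrite big1 ?ltxx// => j _.
  have [->|j0] := eqVneq (slice V j) 0; first by rewrite horner0 mulr0.
  by case: nk; exists j; rewrite ltn_ord.
case: (ex_minnP ex_k) => k /andP[kd vk0] kmin.
have low j : (j < k)%N -> slice V j = 0.
  move=> jk; apply/eqP; apply: contraLR jk => vj0; rewrite -leqNgt.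
  have [jd|dj] := ltnP j d.+1; first by rewrite kmin ?jd.
  by rewrite (leq_trans _ dj)// ltnW.
(* A component of degree 0 is the constant term of [V], which is its value at the origin. *)
have k0 : (0 < k)%N.
  rewrite lt0n; apply: contraNneq vk0 => k0.
  apply/eqP/polyP => i; have := slice_size V k; rewrite k0 => s1.
  rewrite (size1_polyC s1) coef0 coefC; case: eqP => // _.
  have : peval V (point (0 * 0) 0) = 0.
    by rewrite (_ : point _ _ = 0)//; apply/eqP; rewrite point_eq0 mul0r eqxx.
  rewrite (peval_slice _ _ Vd) big_ord_recl big1 ?addr0 => [|j _]; last first.
    by rewrite exprS !mul0r.
  by rewrite expr0 mul1r horner_coef0.
have vge0 x : 0 <= (slice V k).[x].
  apply: (@lowest_coef_ge0 R d.+1 k (fun j => (slice V j).[x])) => //.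
    by move=> j /low ->; rewrite horner0.
  by move=> s s0; rewrite ltW// Vge0// gt_eqF.
(* The opposite ray brings in the sign [(-1) ^+ k]; an odd [k] would then force the slice to vanish
   identically. *)
have vge0' x : 0 <= (-1) ^+ k * (slice V k).[x].
  apply: (@lowest_coef_ge0 R d.+1 k (fun j => (-1) ^+ j * (slice V j).[x])) => //.
    by move=> j /low ->; rewrite horner0 mulr0.
  move=> s s0; under eq_bigr do rewrite mulrA -exprMn.
  by rewrite ltW// Vge0// mulrN1 oppr_eq0 gt_eqF.
have kE : k./2.*2 = k.
  apply: even_halfK; apply: contraNN vk0 => ok; apply/eqP/horner_inj => x.
  have := vge0' x; rewrite -signr_odd ok expr1 mulN1r oppr_ge0 horner0 => vle0.
  by apply/le_anti; rewrite vge0 vle0.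
exists k./2, (slice V k); rewrite kE; split=> //.
- by rewrite -double_gt0 kE.
- by rewrite slice_size.
move=> x; rewrite -oppr_ge0.
set f1 := f (point x 1) ord0 0; set f2 := f (point x 1) ord_max 0.
apply: (@lowest_coef_ge0 R d.+1 k (fun j => - (f1 * (slice V j)^`().[x] +
   f2 * (j%:R * (slice V j).[x] - x * (slice V j)^`().[x])))) => //.
  by move=> j /low ->; rewrite deriv0 horner0 !mulr0 subr0 mulr0 addr0 oppr0.
move=> s s0.
have := Vneg (point (s * x) s); rewrite point_eq0 (gt_eqF s0) andbF => /(_ isT).
have -> : point (s * x) s = s *: point x 1.
  by apply/matrixP => -[[|[|//]] i] j; rewrite !mxE/= ?mulr1.
rewrite fZ /inner big_ord_recl big_ord1 (_ : lift _ _ = ord_max);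
  last exact: val_inj.
rewrite !mxE /f1 /f2 => neg.
have -> : \sum_(j < d.+1) s ^+ j *
    - (f (point x 1) ord0 0 * (slice V j)^`().[x] +
       f (point x 1) ord_max 0 * (j%:R * (slice V j).[x] - x * (slice V j)^`().[x])) =
  - (f (point x 1) ord0 0 * (\sum_(j < d.+1) s ^+ j * (slice V j)^`().[x]) +
     f (point x 1) ord_max 0 * (\sum_(j < d.+1) s ^+ j *
     (j%:R * (slice V j).[x] - x * (slice V j)^`().[x]))).
  rewrite !mulr_sumr -big_split -sumrN; apply: eq_bigr => j _ /=; ring.
rewrite -gradient_slice0// -gradient_slice1//.
have -> : point (s * x) s = s *: point x 1.
  by apply/matrixP => -[[|[|//]] i] j; rewrite !mxE/= ?mulr1.
(* One factor [s] is already attached to the gradient; [s ^+ 2] completes the [s ^+ 3] coming from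
   the homogeneity of [f]. *)
rewrite oppr_ge0 -(pmulr_rle0 _ (exprn_gt0 2 s0)) !mxE.
by apply: le_trans (ltW neg); rewrite le_eqVlt; apply/orP; left; apply/eqP;
  ring.
Qed.

End planar_forms.

(** * Polynomials nearly proportional to a given function *)

Definition coef_norm (R : numDomainType) (n : nat) (p : {poly R}) : R :=
  \sum_(i < n) `|p`_i|.

Lemma coef_norm_ge0 (R : numDomainType) n (p : {poly R}) : 0 <= coef_norm n p.
Proof. exact: sumr_ge0. Qed.

Lemma coef_norm_gt0 (R : numDomainType) n (p : {poly R}) :
  (size p <= n)%N -> p != 0 -> 0 < coef_norm n p.
Proof.
move=> pn p0; rewrite lt_neqAle coef_norm_ge0 andbT eq_sym.
apply: contra p0 => /eqP/psumr_eq0P => p0; apply/eqP/polyP => i; rewrite coef0.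
have [ni|ni] := leqP n i; first by rewrite nth_default// (leq_trans pn).
by apply/normr0_eq0/(p0 _ (Ordinal ni)).
Qed.

Lemma coef_norm_sum (R : numDomainType) n m (c : 'I_m -> R)
    (p : 'I_m -> {poly R}) :
  coef_norm n (\sum_i (c i)%:P * p i) <= \sum_i `|c i| * coef_norm n (p i).
Proof.
under [leRHS]eq_bigr do rewrite mulr_sumr.
rewrite exchange_big; apply: ler_sum => j _ /=; rewrite coef_sum.
by apply: (le_trans (ler_norm_sum _ _ _)); apply: ler_sum => i _;
  rewrite coefCM normrM.
Qed.

(* Interpolate v at n points.  If v / w is almost constant, v is almost a
   multiple of the interpolant L of w, which differs from w at some point. *)
Lemma ratio_not_constant (R : realType) (n : nat) (w : R -> R) :
  (forall x, 0 < w x) ->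
  (forall p : {poly R}, exists x, p.[x] != w x) ->
  exists2 e : R, 0 < e & forall v : {poly R}, v != 0 -> (size v <= n)%N ->
    exists x, e * coef_norm n v < `|v.[x] / w x - v.[0] / w 0|.
Proof.
move=> w_gt0 w_np; case: n => [|n].
  exists 1 => // v v0; rewrite leqn0 size_poly_eq0; move: v0 => /[swap] /eqP ->.
  by rewrite eqxx.
pose t (i : nat) : R := i%:R.
have t_inj : injective t by move=> i j /eqP; rewrite eqr_nat => /eqP.
pose l (i : 'I_n.+1) : {poly R} := tnth (lagrange n.+1 t) i.
pose L : {poly R} := \sum_(i < n.+1) (w (t i))%:P * l i.
have [x Lx] := w_np L.
(* [A] and [B] bound interpolation sums in coefficients and at [x]; [C] appears when the relation at
   [x] is solved for the ratio [F0] below. *)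
pose A := \sum_(i < n.+1) w (t i) * coef_norm n.+1 (l i).
pose B := \sum_(i < n.+1) w (t i) * `|(l i).[x]|.
pose C := (w x + B) / `|L.[x] - w x|.
have A0 : 0 <= A by apply: sumr_ge0 => i _;
  rewrite mulr_ge0 ?coef_norm_ge0 ?ltW.
have B0 : 0 <= B by apply: sumr_ge0 => i _; apply: mulr_ge0 => //; exact: ltW.
have Lx0 : 0 < `|L.[x] - w x| by rewrite normr_gt0 subr_eq0.
have C0 : 0 <= C by rewrite divr_ge0 ?addr_ge0 ?(ltW (w_gt0 _)).
(* With this choice [e * ((C + 1) * A) < 1], which contradicts the last bound on [N]. *)
exists ((C + 1) * A + 1)^-1.
  by rewrite invr_gt0 ltr_wpDl// mulr_ge0// addr_ge0.
move=> v v0 sv; set e := _^-1; set N := coef_norm _ v.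
apply: contrapT => /forallNP near_cst.
have {}near_cst y : `|v.[y] / w y - v.[0] / w 0| <= e * N.
  by rewrite leNgt; apply/negP/near_cst.
set F0 := v.[0] / w 0 in near_cst.
have N0 : 0 < N by exact: coef_norm_gt0.
have e0 : 0 < e by rewrite invr_gt0 ltr_wpDl// mulr_ge0// addr_ge0.
pose r (i : 'I_n.+1) := (v.[t i] / w (t i) - F0) * w (t i).
have r_le i : `|r i| <= e * N * w (t i).
  by rewrite normrM (gtr0_norm (w_gt0 _)) ler_pM2r.
have vE : v = \sum_(i < n.+1) v.[t i]%:P * l i by exact: lagrange_gen.
have vr (i : 'I_n.+1) : v.[t i] = F0 * w (t i) + r i.
  by rewrite /r; field; rewrite gt_eqF.
have vx : v.[x] = F0 * L.[x] + \sum_(i < n.+1) r i * (l i).[x].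
  rewrite {1}vE !horner_sum mulr_sumr -big_split/=; apply: eq_bigr => i _.
  by rewrite !hornerE vr /=; ring.
have rx : `|\sum_(i < n.+1) r i * (l i).[x]| <= e * N * B.
  apply: (le_trans (ler_norm_sum _ _ _)); rewrite mulr_sumr.
  by apply: ler_sum => i _; rewrite normrM mulrA ler_wpM2r.
(* The value [v.[x]] is close to [F0 * L.[x]] by interpolation and to [F0 * w x] by assumption; as
   [L.[x]] and [w x] differ, [F0] is small. *)
have F0_le : `|F0| <= e * N * C.
  rewrite /C mulrA ler_pdivlMr// -normrM.
  have -> : F0 * (L.[x] - w x) = (v.[x] / w x - F0) * w x - \sum_(i < n.+1) r i * (l i).[x].
    by rewrite vx; field; rewrite gt_eqF.
  rewrite (le_trans (ler_normB _ _))// mulrDr lerD//.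
  by rewrite normrM (gtr0_norm (w_gt0 _)) ler_pM2r.
have : N <= e * N * ((C + 1) * A).
  rewrite {1}/N vE (le_trans (coef_norm_sum _ _ _))//.
  rewrite [leRHS]mulrA /A mulr_sumr; apply: ler_sum => i _.
  rewrite mulrA ler_wpM2r ?coef_norm_ge0// vr (le_trans (ler_normD _ _))//.
  rewrite normrM (gtr0_norm (w_gt0 _)) [e * N * _]mulrDr mulr1 mulrDl lerD//.
  by rewrite ler_pM2r.
rewrite mulrAC ler_pMl// leNgt => /negP; apply.
by rewrite /e mulrC ltr_pdivrMr ?mul1r ?ltrDl// -invr_gt0.
Qed.

(** * Oscillation of the lowest part relative to the first integral *)

Lemma is_derive_ge0_homo (R : realType) (g dg : R -> R) :
  (forall x, is_derive x (1 : R) g (dg x)) -> (forall x, 0 <= dg x) ->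
  {homo g : x y / x <= y}.
Proof.
move=> gd dg0 x y xy; apply: (@ger0_derive1_ndecr _ g x y) => //.
- by move=> z _; rewrite derive1E; case: (gd z) => _ ->.
- by apply: derivable_within_continuous => z _; case: (gd z).
Qed.

Lemma normX_le (R : realDomainType) (h i : nat) (x : R) :
  (i <= h.*2)%N -> `|x| ^+ i <= (x ^+ 2 + 1) ^+ h.
Proof.
move=> ih; have A1 : 1 <= x ^+ 2 + 1 by rewrite lerDr sqr_ge0.
have [x1|/ltW x1] := lerP `|x| 1.
  by rewrite (le_trans (exprn_ile1 _ (normr_ge0 x) x1))// exprn_ege1.
rewrite (le_trans (ler_weXn2l x1 ih))// -mul2n exprM real_normK ?num_real//.
by rewrite lerXn2r ?nnegrE ?lerDl ?ler01 ?addr_ge0 ?sqr_ge0.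
Qed.

Lemma coef_norm_horner (R : realDomainType) (h : nat) (v : {poly R}) x :
  (size v <= h.*2.+1)%N ->
  `|v.[x]| <= coef_norm h.*2.+1 v * (x ^+ 2 + 1) ^+ h.
Proof.
move=> sv; rewrite (horner_coef_wide _ sv) mulr_suml.
rewrite (le_trans (ler_norm_sum _ _ _))//; apply: ler_sum => i _.
by rewrite normrM normrX ler_wpM2l// normX_le// -ltnS.
Qed.

(** Multiplied by [x], the derivative has the monomials of [v], with coefficients enlarged at most
    by the degree. *)
Lemma coef_norm_horner_deriv (R : realDomainType) (h : nat) (v : {poly R}) x :
  (size v <= h.*2.+1)%N ->
  `|x * v^`().[x]| <= h.*2%:R * coef_norm h.*2.+1 v * (x ^+ 2 + 1) ^+ h.
Proof.
move=> sv; have sv' : (size v^`() <= h.*2)%N.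
  have [->|v0] := eqVneq v 0; first by rewrite deriv0 size_poly0.
  by rewrite -ltnS (leq_trans (lt_size_deriv v0)).
rewrite (horner_coef_wide _ sv') mulr_sumr (le_trans (ler_norm_sum _ _ _))//.
rewrite /coef_norm big_ord_recl mulrDr mulrDl ler_wpDl ?mulr_ge0 ?exprn_ge0//.
  by rewrite addr_ge0 ?sqr_ge0.
rewrite mulr_sumr mulr_suml; apply: ler_sum => i _.
rewrite coef_deriv mulrC -!mulrA -exprSr normrM normrMn -(mulr_natl `|_|) -mulrA.
by rewrite ler_pM ?mulr_ge0// ?ler_nat ?ltn_ord// ler_wpM2l// normrX normX_le.
Qed.

(** The monomial of top degree [h.*2] is even and cancels; the loss of one degree yields the
    division by [x]. *)
Lemma coef_norm_odd_part (R : realFieldType) (h : nat) (v : {poly R}) x :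
  (size v <= h.*2.+1)%N -> 1 <= x ->
  `|v.[x] - v.[- x]| <= 2 * coef_norm h.*2.+1 v * x ^+ h.*2 / x.
Proof.
move=> sv x1; have x0 : 0 < x by rewrite (lt_le_trans ltr01).
rewrite !(horner_coef_wide _ sv) -sumrB (le_trans (ler_norm_sum _ _ _))//.
rewrite -!mulrA mulr_suml mulr_sumr; apply: ler_sum => i _.
rewrite -mulrBr normrM mulrCA ler_wpM2l//.
have := ltn_ord i; rewrite ltnS leq_eqVlt => /predU1P[->|ih].
  by rewrite [(- x) ^+ _]exprNn -signr_odd odd_double mul1r subrr normr0
    mulr_ge0// divr_ge0 ?exprn_ge0// ltW.
rewrite (le_trans (ler_normB _ _))// !normrX normrN (gtr0_norm x0).
by rewrite -mulr2n -(mulr_natl (_ ^+ i)) ler_wpM2l// ler_pdivlMr// -exprSr ler_weXn2l.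
Qed.

Section first_integral.
Variables (R : realType) (lambda : R) (h : nat).
Hypotheses (lambda_gt0 : 0 < lambda) (h_gt0 : (0 < h)%N).

Let A (x : R) := x ^+ 2 + 1.
Let B (x : R) := 2 * x ^+ 2 + 1.
Let alpha : R := h%:R / (1 + lambda).

Let A_gt0 x : 0 < A x. Proof. by rewrite ltr_wpDl// sqr_ge0. Qed.
Let B_gt0 x : 0 < B x. Proof. by rewrite ltr_wpDl// mulr_ge0// sqr_ge0. Qed.
Let AB x : A x <= B x.
Proof. by rewrite lerD2r ler_peMl ?sqr_ge0// ler1n. Qed.
Let A_ge1 x : 1 <= A x. Proof. by rewrite lerDr sqr_ge0. Qed.
Let alpha_gt0 : 0 < alpha.
Proof. by rewrite divr_gt0 ?ltr0n// addr_gt0. Qed.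

(* The power of degree 2h of the first integral
   (x^2 + y^2) (2 x^2 + y^2)^lambda of the unrotated field, at y = 1. *)
Definition weight x := expR (alpha * (ln (A x) + lambda * ln (B x))).

Lemma weight_gt0 x : 0 < weight x. Proof. exact: expR_gt0. Qed.

Lemma weightN x : weight (- x) = weight x.
Proof. by rewrite /weight /A /B sqrrN. Qed.

(** Replacing [B] by the smaller [A] leaves a power of [A] with exponent
    [alpha * (1 + lambda) = h]. *)
Lemma weight_ge x : (x ^+ 2 + 1) ^+ h <= weight x.
Proof.
rewrite -[_ ^+ h]lnK ?posrE ?exprn_gt0 ?A_gt0// ler_expR lnXn ?A_gt0//.
have -> : ln (x ^+ 2 + 1) *+ h = alpha * (ln (A x) + lambda * ln (A x)).
  by rewrite -mulr_natl /alpha /A; field; rewrite gt_eqF// addr_gt0.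
by rewrite ler_wpM2l ?(ltW alpha_gt0)// lerD2l ler_wpM2l ?(ltW lambda_gt0)// ler_ln ?posrE ?A_gt0 ?B_gt0.
Qed.

(** The logarithmic derivative of [weight]. *)
Let dE x := alpha * (2 * x / A x + lambda * (4 * x / B x)).

Let is_derive_exponent x :
  is_derive x (1 : R) (fun x => alpha * (ln (A x) + lambda * ln (B x))) (dE x).
Proof.
have dA : is_derive x (1 : R) A (2 * x).
  by apply: is_derive_eq; rewrite /GRing.scale/=; ring.
have dB : is_derive x (1 : R) B (4 * x).
  by apply: is_derive_eq; rewrite /GRing.scale/=; ring.
have dlA := @is_derive1_comp _ (@ln R) A x _ _ (is_derive1_ln (A_gt0 x)) dA.
have dlB := @is_derive1_comp _ (@ln R) B x _ _ (is_derive1_ln (B_gt0 x)) dB.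
have d := is_deriveZ alpha (is_deriveD dlA (is_deriveZ lambda dlB)).
apply: (is_derive_eq d); rewrite /dE /GRing.scale/=; ring.
Qed.

Let is_derive_weight x : is_derive x (1 : R) weight (dE x * weight x).
Proof.
have := @is_derive1_comp _ expR _ x _ _ (is_derive_expR _) (is_derive_exponent x).
by rewrite mulrC.
Qed.

Let is_derive_ratio (v : {poly R}) x :
  is_derive x (1 : R) (fun x => v.[x] / weight x) ((v^`().[x] - v.[x] * dE x) / weight x).
Proof.
have w0 : weight x != 0 by rewrite gt_eqF ?weight_gt0.
have d := is_deriveM (is_derive_poly v x) (is_deriveV w0 (is_derive_weight x)).
apply: (is_derive_eq d); rewrite /GRing.scale/=; field.
exact: w0.
Qed.

(** With denominators cleared, the logarithmic derivative of [weight] is the identity excluded by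
    [no_polynomial_first_integral] for [k = h.*2]. *)
Lemma weight_not_poly (p : {poly R}) : irrational lambda ->
  exists x, p.[x] != weight x.
Proof.
move=> lirr; apply: contrapT => /forallNP pw.
have {}pw x : p.[x] = weight x by apply/eqP/negPn/negP/pw.
have hE : h.*2%:R = 2 * alpha * (1 + lambda) :> R.
  by rewrite -mul2n natrM /alpha; field; rewrite gt_eqF// addr_gt0.
apply: (@no_polynomial_first_integral R lambda h.*2 p) => //.
- by rewrite double_gt0.
- by apply/eqP => p0; have := weight_gt0 0; rewrite -pw p0 horner0 ltxx.
apply/horner_inj => x.
have pE : horner p = weight by apply/funext.
have := is_derive_weight x; rewrite -pE => /@derive_val;
  rewrite derive_val => dp.
rewrite !hornerE dp hE /dE.
have -> : x ^+ 2 *+ 2 + 1 = B x by rewrite /B; ring.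
rewrite -/(A x).
have := A_gt0 x; have := B_gt0 x; move: (A x) (B x) => a b b0 a0.
by rewrite /=; field; rewrite !gt_eqF.
Qed.

Lemma ratio_oscillation (v : {poly R}) (tau : R) : 0 <= tau ->
  (size v <= h.*2.+1)%N ->
  (forall x, - 2 * (1 + lambda) * (x ^+ 2 + 1) * (2 * x ^+ 2 + 1) * v^`().[x]
     + 2 * h.*2%:R * x * (2 * x ^+ 2 + 1 + 2 * lambda * (x ^+ 2 + 1)) * v.[x]
     + tau * (- 2 * lambda * x * (x ^+ 2 + 1) * v^`().[x]
         - h.*2%:R * (2 * lambda * (x ^+ 2 + 1) + 2 * (2 * x ^+ 2 + 1)) * v.[x])
     <= 0) ->
  forall x y, v.[x] / weight x - v.[y] / weight y <=
    tau * (4 * h.*2%:R * pi) * coef_norm h.*2.+1 v.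
Proof.
move=> tau0 sv ineq; set N := coef_norm _ v; set k : R := h.*2%:R.
have N0 : 0 <= N by exact: coef_norm_ge0.
have k0 : 0 <= k by exact: ler0n.
have hE : k = 2 * alpha * (1 + lambda).
  by rewrite /k -mul2n natrM /alpha; field; rewrite gt_eqF// addr_gt0.
pose F x := v.[x] / weight x.
(* The derivative of [F] is at least [- 2 * k * tau * N / (1 + x ^+ 2)], a bound that [atan]
   integrates with finite total cost. *)
have F_almost_mono : {homo (fun x => F x + 2 * k * tau * N * atan x) : x y / x <= y}.
  apply: (@is_derive_ge0_homo _ _ (fun x => (v^`().[x] - v.[x] * dE x) / weight x +
     2 * k * tau * N * (1 + x ^+ 2)^-1)).
    by move=> x; apply: is_deriveD (is_derive_ratio v x) _.
  move=> x; have a0 := A_gt0 x; have b0 := B_gt0 x; have w0 := weight_gt0 x.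
  pose D1 := - 2 * lambda * x * A x * v^`().[x] - k * (2 * lambda * A x + 2 * B x) * v.[x].
  have D1_le : `|D1| <= 4 * (1 + lambda) * k * A x * (N * weight x).
    have vx : `|v.[x]| <= N * weight x.
      by rewrite (le_trans (coef_norm_horner x sv))// ler_wpM2l// weight_ge.
    have dvx : `|x * v^`().[x]| <= k * (N * weight x).
      rewrite (le_trans (coef_norm_horner_deriv x sv))// -mulrA ler_wpM2l//.
      by rewrite ler_wpM2l// weight_ge.
    rewrite /D1 (le_trans (ler_normB _ _))//.
    (* This splitting leaves room for [2 * B x <= 4 * A x]. *)
    have -> : 4 * (1 + lambda) * k * A x * (N * weight x) =
      (2 * lambda * A x) * (k * (N * weight x)) + k * (2 * lambda * A x + 4 * A x) * (N * weight x).
      by ring.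
    apply: lerD.
      rewrite (_ : - 2 * lambda * x * A x * _ = - ((2 * lambda * A x) * (x * v^`().[x]))).
        rewrite normrN normrM gtr0_norm ?mulr_gt0// ler_wpM2l// ltW//.
        by rewrite !mulr_gt0.
      by ring.
    have c0 : 0 <= k * (2 * lambda * A x + 2 * B x).
      by rewrite mulr_ge0// addr_ge0// mulr_ge0// ltW// mulr_gt0.
    rewrite normrM (ger0_norm c0) ler_pM// ler_wpM2l// lerD2l /A /B.
    by rewrite -subr_ge0 (_ : _ - _ = 2) ?ler0n//; ring.
  have -> : (v^`().[x] - v.[x] * dE x) / weight x + 2 * k * tau * N / (1 + x ^+ 2) =
    (2 * (1 + lambda) * A x * B x * (v^`().[x] - v.[x] * dE x) +
     4 * (1 + lambda) * k * tau * B x * (N * weight x)) /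
    (2 * (1 + lambda) * A x * B x * weight x).
    rewrite (_ : 1 + x ^+ 2 = A x); last by rewrite addrC.
    by field; rewrite !gt_eqF// addr_gt0.
  rewrite divr_ge0//; last by rewrite ltW// !mulr_gt0// addr_gt0.
  have := ineq x; rewrite -/(A x) -/(B x) -/k.
  rewrite -/D1 => ineqx.
  have -> : 2 * (1 + lambda) * A x * B x * (v^`().[x] - v.[x] * dE x) =
    - (- 2 * (1 + lambda) * A x * B x * v^`().[x] +
        2 * k * x * (B x + 2 * lambda * A x) * v.[x]).
    rewrite /dE hE; move: a0 b0; move: (A x) (B x) => a b a0 b0.
    by field; rewrite !gt_eqF.
  have : tau * D1 >= - (4 * (1 + lambda) * k * tau * B x * (N * weight x)).
    have : - (4 * (1 + lambda) * k * A x * (N * weight x)) <= D1.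
      by rewrite lerNl (le_trans _ D1_le)// -normrN ler_norm.
    move/(ler_wpM2l tau0); apply: le_trans.
    rewrite mulrN lerN2 mulrA ler_wpM2r ?mulr_ge0 ?(ltW w0)//.
    rewrite mulrCA -!mulrA ler_wpM2l// ler_wpM2l ?addr_ge0 ?(ltW lambda_gt0)//.
    rewrite ler_wpM2l// ler_wpM2l//.
  by move: ineqx; set Y := tau * D1; set Z := 4 * _ * _ * _ * _ * _; lra.
set sg := 2 * k * tau * N * pi.
have sg0 : 0 <= 2 * k * tau * N by rewrite !mulr_ge0.
have F_le x y : x <= y -> F x - F y <= sg.
  move=> /F_almost_mono; rewrite -lerBlDr => xy.
  have := atan_gtNpi2 x; have := atan_ltpi2 y => ay ax.
  have : 2 * k * tau * N * (atan y - atan x) <= sg by rewrite ler_wpM2l//; lra.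
  by rewrite mulrBr; move: xy; lra.
(* The weight is even, so only the odd part of [v] contributes, and it has lower degree than the
   weight. *)
have F_inf X : 1 <= X -> F X - F (- X) <= 2 * N / X.
  move=> X1; have X0 : 0 < X by rewrite (lt_le_trans ltr01).
  rewrite /F weightN -mulrBl (le_trans (ler_norm _))// normrM normfV.
  rewrite (gtr0_norm (weight_gt0 _)) ler_pdivrMr ?weight_gt0//.
  rewrite (le_trans (coef_norm_odd_part sv X1))// -!mulrA ler_wpM2l//.
  rewrite ler_wpM2l// mulrC ler_wpM2l ?invr_ge0 ?(ltW X0)//.
  rewrite (le_trans _ (weight_ge X))//.
  by have := @normX_le _ h h.*2 X (leqnn _); rewrite (gtr0_norm X0).
move=> x y; rewrite -/(F x) -/(F y).
have -> : tau * (4 * k * pi) * N = sg + sg by rewrite /sg; ring.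
apply/ler_addgt0Pr => e e0.
(* The path goes from [x] up to [X], jumps to [- X], then goes up to [y]. Each monotone leg costs at
   most [sg], and [X] is large enough for the jump to cost at most [e]. *)
pose X := `|x| + `|y| + 1 + 2 * N / e.
have Ne : 0 <= 2 * N / e by rewrite divr_ge0 ?mulr_ge0// ltW.
have X1 : 1 <= X by rewrite /X; have := normr_ge0 x; have := normr_ge0 y; lra.
have X0 : 0 < X by rewrite (lt_le_trans ltr01).
have := F_le x X; rewrite (le_trans (ler_norm x)) => [/(_ isT) xX|]; last first.
  by rewrite /X; have := normr_ge0 y; lra.
have := F_le (- X) y;
  rewrite lerNl (le_trans (ler_norm (- y))) => [/(_ isT) Xy|].
  have : 2 * N / X <= e.
    rewrite ler_pdivrMr// [e * X]mulrC -ler_pdivrMr//.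
    by rewrite /X; have := normr_ge0 x; have := normr_ge0 y; lra.
  by have := F_inf X X1; lra.
by rewrite normrN /X; have := normr_ge0 x; lra.
Qed.

End first_integral.

(** * Nonexistence of low-degree Lyapunov polynomials *)

(* The first two lines are the derivative of v along the unrotated field,
   the third one its derivative along that field rotated by pi / 2. *)
Definition slice_derivative (R : realType) (lambda tau : R) (h : nat)
    (v : {poly R}) (x : R) : R :=
  - 2 * (1 + lambda) * (x ^+ 2 + 1) * (2 * x ^+ 2 + 1) * v^`().[x]
  + 2 * h.*2%:R * x * (2 * x ^+ 2 + 1 + 2 * lambda * (x ^+ 2 + 1)) * v.[x]
  + tau * (- 2 * lambda * x * (x ^+ 2 + 1) * v^`().[x]
      - h.*2%:R * (2 * lambda * (x ^+ 2 + 1) + 2 * (2 * x ^+ 2 + 1)) * v.[x]).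

(** The oscillation bound and the bound of [ratio_not_constant] are both proportional to the
    coefficient norm, so a single threshold on [tau] serves all [v]. *)
Lemma no_decreasing_slice (R : realType) (lambda : R) (h : nat) :
  0 < lambda -> irrational lambda -> (0 < h)%N ->
  exists2 e : R, 0 < e & forall tau, 0 <= tau < e ->
    forall v : {poly R}, v != 0 -> (size v <= h.*2.+1)%N ->
      ~ (forall x, slice_derivative lambda tau h v x <= 0).
Proof.
move=> l0 lirr h0.
have [e e0 H] := ratio_not_constant h.*2.+1 (weight_gt0 lambda h)
  (fun p => weight_not_poly l0 h0 p lirr).
have K0 : 0 < 4 * h.*2%:R * pi :> R.
  by rewrite !mulr_gt0 ?pi_gt0// ltr0n double_gt0.
exists (e / (4 * h.*2%:R * pi)); first by rewrite divr_gt0.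
move=> tau /andP[tau0]; rewrite ltr_pdivlMr// => taue v v0 sv ineq.
have [x] := H v v0 sv; apply/negP; rewrite -leNgt.
have osc := ratio_oscillation l0 h0 tau0 sv ineq.
rewrite (@le_trans _ _ (tau * (4 * h.*2%:R * pi) * coef_norm h.*2.+1 v))//.
  by rewrite ler_norml osc lerNl opprB osc.
by rewrite ler_wpM2r ?coef_norm_ge0// ltW.
Qed.

(** Only finitely many [h] occur, and the minimum of their thresholds works. *)
Lemma no_decreasing_slice_upto (R : realType) (lambda : R) (d : nat) :
  0 < lambda -> irrational lambda ->
  exists2 e : R, 0 < e & forall tau, 0 <= tau < e ->
    forall h (v : {poly R}), (0 < h)%N -> (h.*2 <= d)%N -> v != 0 ->
      (size v <= h.*2.+1)%N ->
      ~ (forall x, slice_derivative lambda tau h v x <= 0).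
Proof.
move=> l0 lirr; elim: d => [|d [e e0 IH]].
  by exists 1 => // tau _ h v h0; rewrite leqn0 double_eq0 eqn0Ngt h0.
have [h0|h0] := posnP (d.+1)./2.
  exists e => // tau taue h v hp; rewrite leq_eqVlt => /predU1P[hd|];
    last exact: IH.
  by move: h0; rewrite -hd doubleK => h0; rewrite h0 in hp.
have [e' e'0 H] := no_decreasing_slice l0 lirr h0.
exists (Num.min e e'); first by rewrite lt_min e0.
move=> tau /andP[tau0]; rewrite lt_min => /andP[taue taue'] h v hp.
rewrite leq_eqVlt => /predU1P[hd|]; last by apply: IH; rewrite ?tau0.
move: H; rewrite -hd doubleK => H v0 sv; apply: (H tau) => //.
by rewrite tau0.
Qed.

Lemma cubic_field_x (R : realType) (lambda theta : R) (z : 'cV[R]_2) :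
  let x := z ord0 0 in let y := z ord_max 0 in
  cubic_field lambda theta z ord0 0 =
  cos theta * (- 2 * lambda * y * (x ^+ 2 + y ^+ 2) - 2 * y * (2 * x ^+ 2 + y ^+ 2))
  - sin theta * (4 * lambda * x * (x ^+ 2 + y ^+ 2) + 2 * x * (2 * x ^+ 2 + y ^+ 2)).
Proof.
rewrite /= /cubic_field !mxE big_ord_recl big_ord1 !mxE/=.
by rewrite (_ : 1 = ord_max :> 'I_2) ?mulNr//; exact: val_inj.
Qed.

Lemma cubic_field_y (R : realType) (lambda theta : R) (z : 'cV[R]_2) :
  let x := z ord0 0 in let y := z ord_max 0 in
  cubic_field lambda theta z ord_max 0 =
  sin theta * (- 2 * lambda * y * (x ^+ 2 + y ^+ 2) - 2 * y * (2 * x ^+ 2 + y ^+ 2))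
  + cos theta * (4 * lambda * x * (x ^+ 2 + y ^+ 2) + 2 * x * (2 * x ^+ 2 + y ^+ 2)).
Proof.
rewrite /= /cubic_field !mxE big_ord_recl big_ord1 !mxE/=.
by rewrite (_ : 1 = ord_max :> 'I_2)//; exact: val_inj.
Qed.

Lemma col2P (R : realType) (u v : 'cV[R]_2) :
  u ord0 0 = v ord0 0 -> u ord_max 0 = v ord_max 0 -> u = v.
Proof.
move=> uv0 uv1; apply/matrixP => -[[|[|//]] i] j; rewrite [j]ord1.
  by rewrite (_ : Ordinal i = ord0)//; exact: val_inj.
by rewrite (_ : Ordinal i = ord_max)//; exact: val_inj.
Qed.

Lemma cubic_fieldZ (R : realType) (lambda theta s : R) (z : 'cV[R]_2) :
  cubic_field lambda theta (s *: z) = s ^+ 3 *: cubic_field lambda theta z.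
Proof.
by apply: col2P; rewrite [RHS]mxE ?cubic_field_x ?cubic_field_y !mxE; ring.
Qed.

(** Divided by [cos theta], the field is the unrotated one plus [tau = tan theta] times its rotation
    by [pi / 2], so the lowest form yields a slice excluded above. *)
Lemma no_polynomial_lyapunov (R : realType) (lambda : R) (d : nat) :
  0 < lambda -> irrational lambda ->
  exists2 e : R, 0 < e & forall theta, 0 < cos theta ->
    0 <= sin theta -> sin theta < e * cos theta ->
    forall V : mpoly.mpoly 2 R, degree_le V d ->
      ~ polynomial_lyapunov (cubic_field lambda theta) V.
Proof.
move=> l0 lirr; have [e e0 H] := no_decreasing_slice_upto d l0 lirr.
exists e => // theta c0 s0 sc V Vd lyapV.
have [h [v [h0 hd v0 sv ineq]]] :=
  lyapunov_lowest_form (cubic_fieldZ lambda theta) Vd lyapV.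
apply: (H (sin theta / cos theta)) h0 hd v0 sv _.
  by rewrite divr_ge0 ?(ltW c0)//= ltr_pdivrMr.
move=> x; rewrite -(pmulr_rle0 _ c0).
apply: le_trans (ineq x); rewrite le_eqVlt; apply/orP; left; apply/eqP.
rewrite cubic_field_x cubic_field_y !mxE /slice_derivative /=.
by field; rewrite gt_eqF.
Qed.

(** * Lyapunov stability *)

Section planar_field.
Variables (R : realType) (lambda theta : R).
Hypotheses (lambda_gt0 : 0 < lambda) (cos_gt0 : 0 < cos theta)
  (sin_gt0 : 0 < sin theta).

Local Notation f := (cubic_field lambda theta).
Implicit Types z : 'cV[R]_2.

Definition N1 z := z ord0 0 ^+ 2 + z ord_max 0 ^+ 2.
Definition N2 z := 2 * z ord0 0 ^+ 2 + z ord_max 0 ^+ 2.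

(** With [angular], the polar decomposition of the field: [f z] is [radial z] times [z] plus
    [angular z] times [z] rotated by [pi / 2]. *)
Definition radial z :=
  2 * lambda * cos theta * (z ord0 0 * z ord_max 0)
  - 2 * (1 + lambda) * sin theta * N2 z.

Definition angular z :=
  2 * (1 + lambda) * cos theta * N2 z
  + 2 * lambda * sin theta * (z ord0 0 * z ord_max 0).

Lemma cubic_field_polar_x z :
  f z ord0 0 = radial z * z ord0 0 - angular z * z ord_max 0.
Proof. by rewrite cubic_field_x /radial /angular /N2; ring. Qed.

Lemma cubic_field_polar_y z :
  f z ord_max 0 = radial z * z ord_max 0 + angular z * z ord0 0.
Proof. by rewrite cubic_field_y /radial /angular /N2; ring. Qed.

Lemma N1_ge0 z : 0 <= N1 z. Proof. by rewrite addr_ge0 ?sqr_ge0. Qed.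

Lemma N1_le_N2 z : N1 z <= N2 z.
Proof. by rewrite lerD2r ler_peMl ?sqr_ge0// ler1n. Qed.

Lemma N2_le_N1 z : N2 z <= 2 * N1 z.
Proof. by rewrite /N1 mulrDr lerD2l ler_peMl ?sqr_ge0// ler1n. Qed.

Lemma normr_xy_le z : `|z ord0 0 * z ord_max 0| <= N1 z / 2.
Proof.
rewrite /N1 normrM -(real_normK (num_real (z ord0 0)))
  -(real_normK (num_real (z ord_max 0))).
by have := sqr_ge0 (`|z ord0 0| - `|z ord_max 0|); rewrite sqrrB; lra.
Qed.

Lemma N1_le_norm z : N1 z <= 2 * `|z| ^+ 2.
Proof.
have zi (i : 'I_2) : z i 0 ^+ 2 <= `|z| ^+ 2.
  rewrite -(real_normK (num_real (z i 0))) lerXn2r ?nnegrE//.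
  by rewrite [leRHS]/Num.Def.normr/= mx_normrE (le_bigmax _ _ (i, 0)).
by rewrite mulr2n mulrDl !mul1r lerD.
Qed.

Lemma norm_lt z (e : R) : 0 < e -> N1 z < e ^+ 2 -> `|z| < e.
Proof.
move=> e0 ze; rewrite /Num.Def.normr/= mx_normrE;
  apply: bigmax_lt => // -[i j] _.
rewrite [j]ord1/= -(@ltr_pXn2r _ 2)// ?nnegrE ?(ltW e0)// real_normK ?num_real//.
apply: le_lt_trans ze; rewrite /N1.
case: i => -[|[|//]] i.
  by rewrite (_ : Ordinal i = ord0) ?lerDl ?sqr_ge0//; exact: val_inj.
by rewrite (_ : Ordinal i = ord_max) ?lerDr ?sqr_ge0//; exact: val_inj.
Qed.

Lemma is_derive_coord z0 (z : R -> 'cV[R]_2) (i : 'I_2) (t : R) :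
  is_derive t (1 : R) z z0 -> is_derive t (1 : R) (fun t => z t i 0) (z0 i 0).
Proof.
case=> dz <-; apply: DeriveDef; first by have := (derivable_mxP z t 1).1 dz i 0.
by rewrite derive_mx// mxE.
Qed.

Lemma continuous_N1 : continuous N1.
Proof.
by move=> z; apply: (@continuousD R R 'cV[R]_2 (fun z => z ord0 0 ^+ 2)
  (fun z => z ord_max 0 ^+ 2) z); apply: (@continuousM R 'cV[R]_2);
  exact: coord_continuous.
Qed.

Lemma continuous_N2 : continuous N2.
Proof.
move=> z; apply: (@continuousD R R 'cV[R]_2 (fun z => 2 * z ord0 0 ^+ 2)
  (fun z => z ord_max 0 ^+ 2) z); apply: (@continuousM R 'cV[R]_2).
- exact: cst_continuous.
- by apply: (@continuousM R 'cV[R]_2); exact: coord_continuous.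
- exact: coord_continuous.
- exact: coord_continuous.
Qed.

Section curve.
Variables (z : R -> 'cV[R]_2) (t k : R).
Hypothesis dz : is_derive t (1 : R) z (k *: f (z t)).

(** The speed factor [k] covers trajectories, where it is 1, and orbits parametrized by the angle,
    where it is the inverse of [angular]. *)
Lemma is_derive_N1 :
  is_derive t (1 : R) (fun t => N1 (z t)) (k * (2 * radial (z t) * N1 (z t))).
Proof.
have dx := is_derive_coord ord0 dz; have dy := is_derive_coord ord_max dz.
have d := is_deriveD (is_deriveX 2 dx) (is_deriveX 2 dy).
apply: (is_derive_eq d); rewrite ![(_ *: f _) _ _]mxE /GRing.scale/=.
by rewrite cubic_field_polar_x cubic_field_polar_y /N1; ring.
Qed.

Lemma is_derive_N2 :
  is_derive t (1 : R) (fun t => N2 (z t))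
    (k * (2 * radial (z t) * N2 (z t)
          - 2 * angular (z t) * (z t ord0 0 * z t ord_max 0))).
Proof.
have dx := is_derive_coord ord0 dz; have dy := is_derive_coord ord_max dz.
have d := is_deriveD (is_deriveZ 2 (is_deriveX 2 dx)) (is_deriveX 2 dy).
apply: (is_derive_eq d); rewrite ![(_ *: f _) _ _]mxE /GRing.scale/=.
by rewrite cubic_field_polar_x cubic_field_polar_y /N2; ring.
Qed.

End curve.

Section lyapunov.
Variables p q : nat.
Hypothesis approx : `|lambda * q.+1%:R - p.+1%:R| <= q.+1%:R * sin theta.

(* For p / q = lambda this would be a power of the first integral of the
   unrotated field; an error of sin theta on lambda is affordable. *)
Definition lyap z := N1 z ^+ q.+1 * N2 z ^+ p.+1.

Lemma lyap_ge z : N1 z ^+ (q.+1 + p.+1) <= lyap z.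
Proof.
rewrite exprD ler_wpM2l ?exprn_ge0 ?N1_ge0// lerXn2r ?nnegrE ?N1_ge0 ?N1_le_N2//.
exact: le_trans (N1_ge0 z) (N1_le_N2 z).
Qed.

Lemma lyap_ge0 z : 0 <= lyap z.
Proof. exact: le_trans (exprn_ge0 _ (N1_ge0 z)) (lyap_ge z). Qed.

(** The constant is placed inside the power, at the cost of enlarging it, so that comparing two
    values of [lyap] reduces to comparing roots. *)
Lemma lyap_le z : lyap z <= (2 ^+ p.+1 * N1 z) ^+ (q.+1 + p.+1).
Proof.
apply: (@le_trans _ _ (2 ^+ p.+1 * N1 z ^+ (q.+1 + p.+1))).
  rewrite exprD mulrCA ler_wpM2l ?exprn_ge0 ?N1_ge0// -exprMn.
  rewrite lerXn2r ?nnegrE ?mulr_ge0 ?N1_ge0 ?N2_le_N1//.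
  exact: le_trans (N1_ge0 z) (N1_le_N2 z).
rewrite exprMn ler_wpM2r ?exprn_ge0 ?N1_ge0// ler_eXnr//.
by rewrite exprn_ege1// ler1n.
Qed.

(** The left side is the derivative of [lyap] up to the factor [N1 z ^+ q.+1 * N2 z ^+ p]. Its term
    without [sin theta] carries [lambda * Q - P]; by [approx] it is absorbed by half of the negative
    term in [b ^+ 2]. *)
Lemma lyap_factor z :
  2 * radial z * (q.+1 + p.+1)%:R * N2 z
    - 2 * p.+1%:R * angular z * (z ord0 0 * z ord_max 0)
  <= - 2 * sin theta * N1 z * N2 z.
Proof.
have a0 := N1_ge0 z; have ab := N1_le_N2 z; have xy := normr_xy_le z.
have b0 : 0 <= N2 z := le_trans a0 ab.
have c1 : cos theta <= 1 := cos_le1 theta.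
set w := z ord0 0 * z ord_max 0; set b := N2 z in ab b0 *;
  set a := N1 z in a0 ab xy *.
set Q : R := q.+1%:R; set P : R := p.+1%:R.
have Q1 : 1 <= Q by rewrite ler1n.
have P0 : 0 <= P by rewrite ler0n.
have -> : 2 * radial z * (q.+1 + p.+1)%:R * b - 2 * P * angular z * w =
  4 * b * (cos theta * w * (lambda * Q - P))
  - 4 * (Q + P) * (1 + lambda) * sin theta * b ^+ 2
  - 4 * P * lambda * sin theta * w ^+ 2.
  by rewrite /radial /angular -/w -/b natrD -/Q -/P; ring.
have t1 : cos theta * w * (lambda * Q - P) <= a / 2 * (Q * sin theta).
  rewrite (le_trans (ler_norm _))// normrM ler_pM// normrM (gtr0_norm cos_gt0).
  by rewrite (le_trans _ xy)// ler_piMl.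
have t2 : b * (cos theta * w * (lambda * Q - P)) <= b * (a / 2 * (Q * sin theta)).
  by rewrite ler_wpM2l.
have t3 : Q * sin theta * b * a <= (Q + P) * (1 + lambda) * sin theta * b ^+ 2.
  have u1 : Q <= (Q + P) * (1 + lambda).
    have Ql : 0 <= Q * lambda by rewrite mulr_ge0// ltW.
    have Pl : 0 <= P * lambda by rewrite mulr_ge0// ltW.
    by rewrite mulrDl !mulrDr; lra.
  have u2 : b * a <= b ^+ 2 by rewrite expr2 ler_wpM2l.
  rewrite (_ : Q * _ * b * a = sin theta * (Q * (b * a))); last by ring.
  rewrite (_ : _ * b ^+ 2 = sin theta * ((Q + P) * (1 + lambda) * b ^+ 2));
    last by ring.
  by rewrite ler_wpM2l ?(ltW sin_gt0)// ler_pM// mulr_ge0.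
have t4 : 0 <= P * lambda * sin theta * w ^+ 2.
  by rewrite mulr_ge0 ?sqr_ge0// !mulr_ge0 ?(ltW lambda_gt0) ?(ltW sin_gt0).
have t5 : sin theta * a * b <= Q * sin theta * b * a.
  rewrite (_ : _ * b * a = Q * (sin theta * a * b)); last by ring.
  by rewrite ler_peMl// !mulr_ge0 ?(ltW sin_gt0).
by move: t2 t3 t4 t5; lra.
Qed.

Lemma N1_le_of_lyap z w : lyap z <= lyap w -> N1 z <= 2 ^+ p.+1 * N1 w.
Proof.
move=> zw; rewrite -(@ler_pXn2r _ (q.+1 + p.+1))// ?nnegrE ?N1_ge0//;
  last first.
  by rewrite mulr_ge0 ?N1_ge0.
exact: le_trans (lyap_ge _) (le_trans zw (lyap_le _)).
Qed.

Lemma lyap_cont : continuous lyap.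
Proof.
move=> x; apply: (@continuousM R 'cV[R]_2).
  by apply: continuous_comp (@exprn_continuous _ _ _); exact: continuous_N1.
by apply: continuous_comp (@exprn_continuous _ _ _); exact: continuous_N2.
Qed.

Lemma is_derive_lyap (z : R -> 'cV[R]_2) (t k : R) : 0 <= k ->
  is_derive t (1 : R) z (k *: f (z t)) ->
  exists2 l : R, is_derive t (1 : R) (fun t => lyap (z t)) l &
    l <= k * (- 2 * sin theta * N1 (z t) * lyap (z t)).
Proof.
move=> k0 dz.
have d := is_deriveM (is_deriveX q.+1 (is_derive_N1 dz)) (is_deriveX p.+1 (is_derive_N2 dz)).
move: d; rewrite !exprfctE => d; eexists; first exact: d.
rewrite /GRing.scale/=.
set a := N1 (z t); set b := N2 (z t); set r := radial _; set g := angular _.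
set w := z t ord0 0 * _.
have -> : - 2 * sin theta * a * lyap (z t) =
  (a ^+ q.+1 * b ^+ p) * (- 2 * sin theta * a * b).
  by rewrite /lyap -/a -/b [b ^+ p.+1]exprSr; ring.
have c0 : 0 <= a ^+ q.+1 * b ^+ p.
  by rewrite mulr_ge0 ?exprn_ge0// ?(le_trans (N1_ge0 _) (N1_le_N2 _))// N1_ge0.
apply: le_trans (ler_wpM2l k0 (ler_wpM2l c0 (lyap_factor (z t)))).
rewrite -/b -/r -/g -/w natrD le_eqVlt; apply/orP; left; apply/eqP.
by rewrite (exprS b) (exprS a); move: (q.+1%:R) (p.+1%:R) => Q P; ring.
Qed.

Section trajectory.
Variable z : R -> 'cV[R]_2.
Hypothesis z_sol : solution f z.

Lemma continuous_lyap :
  {within [set t : R | 0 <= t], continuous (fun t => lyap (z t))}%classic.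
Proof.
move=> t; apply: (@continuous_comp _ _ _
  (z : subspace [set t : R | 0 <= t]%classic -> _) lyap).
  exact: z_sol.1.
exact: lyap_cont.
Qed.

Let dlyap (t : R) : 0 < t ->
  exists2 l : R, is_derive t (1 : R) (fun t => lyap (z t)) l &
    l <= - 2 * sin theta * N1 (z t) * lyap (z t).
Proof.
move=> t0; have := @is_derive_lyap z t 1 ler01; rewrite scale1r mul1r; apply.
exact: z_sol.2.
Qed.

(** Used with [k = 0] for monotonicity, and with [k > 0] to exclude trajectories staying away from
    the origin. *)
Lemma lyap_decrease (k : R) :
  (forall t : R, 0 < t -> k <= 2 * sin theta * N1 (z t) * lyap (z t)) ->
  forall s t, 0 <= s -> s <= t -> lyap (z t) + k * t <= lyap (z s) + k * s.
Proof.
move=> kle s t; apply: (@ler0_derive1_nincry R (fun t => lyap (z t) + k * t) 0) => [u|u|].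
- rewrite in_itv/= andbT => u0; have [l d _] := dlyap u0.
  by case: (is_deriveD d (is_deriveZ k (is_derive_id u (1 : R)))).
- rewrite in_itv/= andbT => u0; have [l d l_le] := dlyap u0.
  rewrite derive1E;
    case: (is_deriveD d (is_deriveZ k (is_derive_id u (1 : R)))) => _ ->.
  by rewrite /GRing.scale/= mulr1; move: l_le (kle u u0); lra.
rewrite (_ : [set` _]%classic = [set t : R | 0 <= t]%classic); last first.
  by apply/seteqP; split=> u /=; rewrite in_itv/= andbT.
apply: (@within_continuousD R R R _ (fun t => lyap (z t)) (fun t => k * t));
  first exact: continuous_lyap.
by apply: continuous_subspaceT => u; apply: continuousM;
  [exact: cst_continuous|exact: cvg_id].
Qed.

Lemma N1_bound s t : 0 <= s -> s <= t ->
  N1 (z t) <= 2 ^+ p.+1 * N1 (z s).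
Proof.
move=> s0 st; have := @lyap_decrease 0 _ s t s0 st;
  rewrite !mul0r !addr0 => dec.
have {}dec : lyap (z t) <= lyap (z s).
  apply: dec => u _; rewrite mulr_ge0 ?lyap_ge0//.
  by rewrite !mulr_ge0 ?(ltW sin_gt0) ?N1_ge0.
exact: N1_le_of_lyap.
Qed.

Lemma N1_small (e : R) : 0 < e -> exists2 t : R, 0 <= t & N1 (z t) < e.
Proof.
move=> e0; apply: contrapT => big.
have {}big t : 0 <= t -> e <= N1 (z t).
  by move=> t0; rewrite leNgt; apply/negP => te; apply: big; exists t.
pose k := 2 * sin theta * e * e ^+ (q.+1 + p.+1).
have k0 : 0 < k by rewrite !mulr_gt0 ?exprn_gt0.
have kle (t : R) : 0 < t -> k <= 2 * sin theta * N1 (z t) * lyap (z t).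
  move=> /ltW/big et;
    rewrite ler_pM// ?mulr_ge0 ?exprn_ge0 ?(ltW sin_gt0) ?(ltW e0)//.
    by rewrite ler_wpM2l// mulr_ge0// ltW.
  by rewrite (le_trans _ (lyap_ge _))// lerXn2r ?nnegrE ?(ltW e0) ?N1_ge0.
(* At this time the linear decrease would bring [lyap] down to at most -1. *)
pose T := (lyap (z 0) + 1) / k.
have T0 : 0 <= T by rewrite divr_ge0 ?(ltW k0)// addr_ge0 ?lyap_ge0.
have := lyap_decrease kle (lexx 0) T0;
  rewrite mulr0 addr0 /T mulrCA divff ?gt_eqF//.
by have := lyap_ge0 (z T); rewrite /T; lra.
Qed.

End trajectory.

Lemma lyapunov_stable (eps : R) : 0 < eps ->
  exists2 delta : R, 0 < delta & forall z : R -> 'cV[R]_2, solution f z ->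
    `|z 0| < delta -> forall t : R, 0 <= t -> `|z t| < eps.
Proof.
move=> e0; pose K : R := 2 ^+ p.+1.
have K1 : 1 <= K by rewrite exprn_ege1// ler1n.
have K0 : 0 < K by rewrite (lt_le_trans ltr01).
(* Then [N1 (z t)] stays below [K * 2 * (eps / (2 * K)) ^+ 2 = eps ^+ 2 / (2 * K)]; the inner 2
   compares [N1] with the squared max norm. *)
exists (eps / (2 * K)); first by rewrite divr_gt0// mulr_gt0.
move=> z z_sol zd t t0; apply: norm_lt => //.
apply: le_lt_trans (N1_bound z_sol (lexx 0) t0) _; rewrite -/K.
have zd2 : `|z 0| ^+ 2 < (eps / (2 * K)) ^+ 2.
  by rewrite ltr_pXn2r// nnegrE// divr_ge0 ?mulr_ge0// ltW.
have : N1 (z 0) < 2 * (eps / (2 * K)) ^+ 2.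
  by apply: le_lt_trans (N1_le_norm _) _; rewrite ltr_pM2l.
rewrite -(ltr_pM2l K0) => /lt_le_trans; apply.
rewrite (_ : K * _ = eps ^+ 2 / (2 * K)); last by field; rewrite gt_eqF.
rewrite ler_pdivrMr ?mulr_gt0// ler_peMr ?sqr_ge0//.
by move: K1; lra.
Qed.

(** [N1_small] gives one time at which the trajectory is small, and [N1_bound] started there
    controls all later times. *)
Lemma lyapunov_attractive (z : R -> 'cV[R]_2) : solution f z ->
  (z t @[t --> +oo] --> (0 : 'cV[R]_2))%classic.
Proof.
move=> z_sol; apply/cvgrPdist_lt => e e0.
have K0 : 0 < 2 ^+ p.+1 :> R by rewrite exprn_gt0.
have [T T0 zT] := N1_small z_sol (divr_gt0 (exprn_gt0 2 e0) K0).
near=> t; rewrite sub0r normrN; apply: norm_lt => //.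
have Tt : T <= t by near: t; apply: nbhs_pinfty_ge; exact: num_real.
apply: le_lt_trans (N1_bound z_sol T0 Tt) _.
by rewrite mulrC -ltr_pdivlMr.
Unshelve. all: by end_near. Qed.

End lyapunov.

(** The choice of [q] gives [q.+1%:R * sin theta >= 1], so any integer within 1 of
    [lambda * q.+1%:R] is acceptable. *)
Lemma rational_approximation :
  exists p q : nat, `|lambda * q.+1%:R - p.+1%:R| <= q.+1%:R * sin theta.
Proof.
pose q := Num.truncn (sin theta)^-1; pose p := Num.truncn (lambda * q.+1%:R).
exists p, q; have si0 : 0 <= (sin theta)^-1 by rewrite invr_ge0 ltW.
have lq0 : 0 <= lambda * q.+1%:R by rewrite mulr_ge0// ltW.
have /andP[_ q1] := truncn_itv si0; have /andP[p1 p2] := truncn_itv lq0.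
apply: (@le_trans _ _ 1); last by rewrite -ler_pdivrMr// mul1r ltW.
by rewrite -/p in p1 p2; rewrite ler_norml; move: p1 p2; rewrite -natr1; lra.
Qed.
End planar_field.

(** * Existence of trajectories *)

(** The integral starts at [b], where continuity beyond [a] still holds; subtracting its value at
    [c] normalizes it. *)
Lemma exists_primitive (R : realType) (f : R -> R) (a b c : R) : a < b -> b < c ->
  (forall x, a < x -> {for x, continuous f}) ->
  exists2 F : R -> R, F c = 0 & forall x, b < x -> is_derive x (1 : R) F (f x).
Proof.
move=> ab bc cf;
  pose G x := (\int[lebesgue_measure]_(t in `[b, x]%classic) f t)%R.
have dG x : b < x -> is_derive x (1 : R) G (f x).
  move=> bx; have x1 : x < x + 1 by rewrite ltrDl.
  have [|d <-] := continuous_FTC1_closed x1 _ bx (cf x (lt_trans ab bx)).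
    apply: continuous_compact_integrable; first exact: segment_compact.
    apply: continuous_in_subspaceT => y; rewrite inE/= in_itv/= => /andP[by_ _].
    exact: cf (lt_le_trans ab by_).
  by rewrite derive1E; exact: derivableP.
exists (fun x => G x - G c); first by rewrite subrr.
move=> x bx; have d := is_deriveB (dG x bx) (is_derive_cst (G c) x (1 : R)).
by apply: (is_derive_eq d); rewrite subr0.
Qed.

(* Separation of variables: phi is the inverse of a primitive of 1 / h, which
   is onto [0, +oo[ because h is bounded. *)
Lemma autonomous_ode (R : realType) (h : R -> R) (a M : R) : a < 0 ->
  (forall x, a < x -> {for x, continuous h}) ->
  (forall x, a < x -> 0 < h x) -> (forall x, 0 <= x -> h x <= M) ->
  exists phi : R -> R, [/\ phi 0 = 0, (forall t : R, 0 <= t -> 0 <= phi t) &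
    forall t : R, 0 <= t -> is_derive t (1 : R) phi (h (phi t))].
Proof.
(* Integration starts at [b] and inversion takes place right of [c]; having [c < 0] keeps 0
   interior, so that [phi] has a two-sided derivative at [t = 0]. *)
move=> a0 ch h0 hM; pose b := a / 2; pose c := b / 2.
have [ab bc c0] : [/\ a < b, b < c & c < 0] by rewrite /c /b; split; lra.
have [T T0 dT] : exists2 T : R -> R, T 0 = 0 &
    forall x, b < x -> is_derive x (1 : R) T (h x)^-1.
  apply: (@exists_primitive _ (fun x => (h x)^-1) a b 0) => //;
    first exact: lt_trans c0.
  by move=> x ax; apply: continuousV; [rewrite gt_eqF ?h0|exact: ch].
have cT x : b < x -> {for x, continuous T}.
  by move=> /dT [d _]; apply/differentiable_continuous/derivable1_diffP.
have T_incr x y : c <= x -> x < y -> T x < T y.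
  move=> cx xy; apply: (@gtr0_derive1_incr _ T c y) => //.
  - by move=> u; rewrite in_itv/= => /andP[cu _]; case: (dT u (lt_trans bc cu)).
  - move=> u; rewrite in_itv/= => /andP[cu _]; rewrite derive1E.
    case: (dT u (lt_trans bc cu)) => _ ->.
    by rewrite invr_gt0 h0// (lt_trans ab)// (lt_trans bc).
  - apply: continuous_in_subspaceT => u; rewrite inE/= in_itv/= => /andP[cu _].
    exact: cT (lt_le_trans bc cu).
have T_inj x y : c <= x -> c <= y -> T x = T y -> x = y.
  move=> cx cy Txy; case: (ltgtP x y) => // xy.
    by have := T_incr _ _ cx xy; rewrite Txy ltxx.
  by have := T_incr _ _ cy xy; rewrite Txy ltxx.
have M0 : 0 < M by rewrite (lt_le_trans (h0 0 a0)) ?hM.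
have T_ge x : 0 <= x -> x / M <= T x.
  move=> x0; rewrite -subr_ge0.
  have -> : 0 = T 0 - 0 / M by rewrite T0 mul0r subrr.
  have dTM (u : R) : b < u -> is_derive u (1 : R) (fun x => T x - x / M) ((h u)^-1 - M^-1).
    move=> bu; have d := is_deriveB (dT u bu) (is_deriveM (is_derive_id u (1 : R))
      (is_derive_cst M^-1 u (1 : R))).
    by apply: (is_derive_eq d); rewrite /GRing.scale/= mulr0 add0r mulr1.
  have b0 : b < 0 by exact: lt_trans c0.
  apply: (@ger0_derive1_ndecr _ (fun x => T x - x / M) 0 x) => //.
  - by move=> u; rewrite in_itv/= => /andP[u0 _];
    case: (dTM u (lt_trans b0 u0)).
  - move=> u; rewrite in_itv/= => /andP[u0 _]; rewrite derive1E.
    case: (dTM u (lt_trans b0 u0)) => _ ->; rewrite subr_ge0 lef_pV2 ?posrE//.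
      by rewrite hM// ltW.
    by rewrite h0// (lt_trans a0).
  - apply: continuous_in_subspaceT => u; rewrite inE/= in_itv/= => /andP[u0 _].
    have [d _] := dTM u (lt_le_trans b0 u0).
    exact/differentiable_continuous/derivable1_diffP.
have T_onto t : T c <= t -> exists2 x, c <= x & T x = t.
  (* By [T_ge], [T] exceeds [t] at this point, which bounds the interval for the intermediate value
     theorem. *)
  move=> ct; pose y := `|t| * M.
  have y0 : 0 <= y by rewrite mulr_ge0// ltW.
  have cy : c <= y by rewrite (le_trans (ltW c0)).
  have cTcy : {within `[c, y], continuous T}%classic.
    apply: continuous_in_subspaceT => u; rewrite inE/= in_itv/= => /andP[cu _].
    exact: cT (lt_le_trans bc cu).
  have ty : t <= T y.
    by rewrite (le_trans _ (T_ge y y0))// mulfK ?gt_eqF// ler_norm.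
  have [|x] := IVT cy cTcy (v := t).
    by rewrite ge_min ct le_max ty orbT.
  by rewrite in_itv/= => /andP[cx _]; exists x.
(* The default 0 is taken only for [t < T c], where no such preimage exists. *)
pose phi t := xget 0 [set x | c <= x /\ T x = t]%classic.
have phiP t : T c <= t -> c <= phi t /\ T (phi t) = t.
  by move=> /T_onto[x cx Tx]; rewrite /phi; case: xgetP => [_ ->//|/(_ x)[]].
have phiT x : c < x -> phi (T x) = x.
  move=> cx; have [cp Tp] := phiP (T x) (ltW (T_incr _ _ (lexx c) cx)).
  exact: T_inj (ltW cx) Tp.
have Tc0 : T c < 0 by rewrite -T0 T_incr.
exists phi; split.
- by rewrite -{1}T0 phiT.
- move=> t t0; have [cp Tp] := phiP t (le_trans (ltW Tc0) t0).
  rewrite leNgt; apply/negP => /(T_incr _ _ cp); rewrite Tp T0.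
  by apply/negP; rewrite -leNgt.
move=> t t0; have [cp Tp] := phiP t (le_trans (ltW Tc0) t0).
have {}cp : c < phi t.
  rewrite lt_neqAle cp andbT; apply/eqP => cE.
  by move: Tc0; rewrite cE Tp ltNge t0.
have nearc : \forall x \near phi t, c < x by exact: lt_nbhsr.
rewrite -{1}Tp -[h _]invrK; apply: is_derive_inverse.
- by near=> x; apply: phiT; near: x.
- near=> x; apply: cT; apply: lt_trans bc _; near: x; exact: nearc.
- by apply: dT; exact: lt_trans cp.
- by rewrite invr_eq0 gt_eqF// h0// (lt_trans ab)// (lt_trans bc).
Unshelve. all: by end_near. Qed.
Lemma ord2P (i : 'I_2) : i = ord0 \/ i = ord_max.
Proof. by case: i => -[|[|//]] i; [left|right]; exact: val_inj. Qed.

Lemma is_derive_col2 (R : realType) (z : R -> 'cV[R]_2) (w : 'cV[R]_2) (t : R) :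
  is_derive t (1 : R) (fun t => z t ord0 0) (w ord0 0) ->
  is_derive t (1 : R) (fun t => z t ord_max 0) (w ord_max 0) ->
  is_derive t (1 : R) z w.
Proof.
move=> [dx xE] [dy yE].
have dz : derivable z t 1.
  apply/derivable_mxP => i j; rewrite [j]ord1.
  have [->|->] := ord2P i; [exact: dx|exact: dy].
by apply: DeriveDef => //; apply: col2P; rewrite derive_mx// mxE.
Qed.

Section existence.
Variables (R : realType) (lambda theta : R).
Hypotheses (lambda_gt0 : 0 < lambda) (cos_gt0 : 0 < cos theta)
  (sin_gt0 : 0 < sin theta) (sin_le_cos : sin theta <= cos theta).

Local Notation f := (cubic_field lambda theta).

(** Since [sin theta <= cos theta], the mixed term is absorbed by the [lambda] part of the definite
    term, leaving [2 * cos theta * N2 z]. *)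
Lemma angular_gt0 (z : 'cV[R]_2) : 0 < N1 z -> 0 < angular lambda theta z.
Proof.
move=> z0; have := N1_le_N2 z; have := normr_xy_le z; rewrite /angular.
rewrite ler_norml => /andP[xy _] N12; move: xy N12 z0.
move: (N1 z) (N2 z) (z ord0 0 * _) => a b w aw ab a0.
have t1 : sin theta * (lambda * - w) <= cos theta * (lambda * b).
  apply: (@le_trans _ _ (sin theta * (lambda * b))).
    by rewrite ler_pM2l// ler_pM2l//; lra.
  by rewrite ler_pM2r// mulr_gt0//; lra.
have t2 : 0 < cos theta * b by rewrite mulr_gt0//; lra.
by move: t1 t2; lra.
Qed.

Lemma angular_le (z : 'cV[R]_2) :
  angular lambda theta z <= (4 * (1 + lambda) * cos theta + lambda * sin theta) * N1 z.
Proof.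
have := N2_le_N1 z; have := normr_xy_le z; rewrite /angular.
rewrite ler_norml => /andP[_ xy] N12; rewrite [leRHS]mulrDl; apply: lerD.
  rewrite (_ : 4 * _ * _ * _ = 2 * (1 + lambda) * cos theta * (2 * N1 z));
    last by ring.
  by rewrite ler_wpM2l// !mulr_ge0 ?(ltW cos_gt0)// addr_ge0// ltW.
rewrite (_ : lambda * _ * _ = 2 * lambda * sin theta * (N1 z / 2));
  last by field.
by rewrite ler_wpM2l// !mulr_ge0 ?(ltW lambda_gt0) ?(ltW sin_gt0).
Qed.

Section orbit.
Variable z0 : 'cV[R]_2.
Hypothesis N1z0 : 0 < N1 z0.

(** The point [z0] rotated by the angle [x]. *)
Let u (x : R) : 'cV[R]_2 := point (cos x * z0 ord0 0 - sin x * z0 ord_max 0)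
                                  (cos x * z0 ord_max 0 + sin x * z0 ord0 0).

Let ux x : u x ord0 0 = cos x * z0 ord0 0 - sin x * z0 ord_max 0.
Proof. by rewrite mxE. Qed.

Let uy x : u x ord_max 0 = cos x * z0 ord_max 0 + sin x * z0 ord0 0.
Proof. by rewrite mxE. Qed.

Let N1_u x : N1 (u x) = N1 z0.
Proof.
rewrite /N1 ux uy; have := cos2Dsin2 x; move: (cos x) (sin x) => c s cs.
rewrite -[RHS]mul1r -cs; ring.
Qed.

Let derive_ux x : is_derive x (1 : R) (fun x => u x ord0 0) (- u x ord_max 0).
Proof.
have d := is_deriveB (is_deriveM (is_derive_cos x) (is_derive_cst (z0 ord0 0) x (1 : R)))
  (is_deriveM (is_derive_sin x) (is_derive_cst (z0 ord_max 0) x (1 : R))).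
under eq_fun do rewrite ux.
apply: (is_derive_eq d); rewrite uy /GRing.scale/=; ring.
Qed.

Let derive_uy x : is_derive x (1 : R) (fun x => u x ord_max 0) (u x ord0 0).
Proof.
have d := is_deriveD (is_deriveM (is_derive_cos x) (is_derive_cst (z0 ord_max 0) x (1 : R)))
  (is_deriveM (is_derive_sin x) (is_derive_cst (z0 ord0 0) x (1 : R))).
under eq_fun do rewrite uy.
apply: (is_derive_eq d); rewrite ux /GRing.scale/=; ring.
Qed.

Let derivable_ui i x : derivable (fun x => u x i 0) x 1.
Proof.
by have [->|->] := ord2P i; [case: (derive_ux x)|case: (derive_uy x)].
Qed.

Let u_cont : continuous u.
Proof.
move=> x; apply/differentiable_continuous/derivable1_diffP/derivable_mxP => i j.
by rewrite [j]ord1; exact: derivable_ui.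
Qed.

Let continuous_quadratic (k l : R) :
  continuous (fun z : 'cV[R]_2 => k * N2 z + l * (z ord0 0 * z ord_max 0)).
Proof.
move=> z; apply: (@continuousD R R 'cV[R]_2 (fun z => k * N2 z)
  (fun z => l * (z ord0 0 * z ord_max 0)) z); apply: (@continuousM R 'cV[R]_2).
- exact: cst_continuous.
- exact: continuous_N2.
- exact: cst_continuous.
- by apply: (@continuousM R 'cV[R]_2); exact: coord_continuous.
Qed.

Lemma continuous_angular : continuous (angular lambda theta : 'cV[R]_2 -> R).
Proof. exact: continuous_quadratic. Qed.

Lemma continuous_radial : continuous (radial lambda theta : 'cV[R]_2 -> R).
Proof.
rewrite (_ : radial lambda theta = fun z : 'cV[R]_2 =>
  - (2 * (1 + lambda) * sin theta) * N2 z
  + 2 * lambda * cos theta * (z ord0 0 * z ord_max 0)).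
  exact: continuous_quadratic.
by apply/funext => z; rewrite /radial; ring.
Qed.

(** In polar form the logarithm [g] of the scaling factor satisfies [g' = radial / angular]. This
    ratio is homogeneous of degree 0, so it depends on the angle alone and [g] is a primitive. The
    range beyond -1 leaves a margin around the initial angle 0. *)
Lemma exists_orbit_parametrization : exists y : R -> 'cV[R]_2,
  [/\ y 0 = z0, (forall x, 0 < N1 (y x)) &
    forall x : R, -1 < x ->
      is_derive x (1 : R) y ((angular lambda theta (y x))^-1 *: f (y x))].
Proof.
have u_pos x : 0 < angular lambda theta (u x) by rewrite angular_gt0// N1_u.
pose rho x := radial lambda theta (u x) / angular lambda theta (u x).
have rho_cont : continuous rho.
  move=> x; apply: (@continuousM R R (fun x => radial lambda theta (u x))
      (fun x => (angular lambda theta (u x))^-1) x).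
    by apply: continuous_comp; [exact: u_cont|exact: continuous_radial].
  apply: continuousV; first by rewrite gt_eqF.
  by apply: continuous_comp; [exact: u_cont|exact: continuous_angular].
have [g g0 dg] : exists2 g : R -> R, g 0 = 0 &
    forall x : R, -1 < x -> is_derive x (1 : R) g (rho x).
  have n21 : -2 < -1 :> R by rewrite ltrN2 ltr1n.
  exact: exists_primitive n21 (ltrN10 R) (fun x _ => rho_cont x).
pose y x := expR (g x) *: u x.
have N1y x : N1 (y x) = expR (g x) ^+ 2 * N1 z0.
  by rewrite -(N1_u x) /N1 !mxE; ring.
exists y; split=> [|x|x x1].
- rewrite /y g0 expR0 scale1r; apply: col2P; rewrite ?ux ?uy cos0 sin0; ring.
- by rewrite N1y mulr_gt0// exprn_gt0// expR_gt0.
have dE := @is_derive1_comp _ expR g x _ _ (is_derive_expR _) (dg x x1).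
have a0 := u_pos x.
have yx : y x ord0 0 = expR (g x) * u x ord0 0 by rewrite mxE.
have yy : y x ord_max 0 = expR (g x) * u x ord_max 0 by rewrite mxE.
have ang : angular lambda theta (y x) = expR (g x) ^+ 2 * angular lambda theta (u x).
  by rewrite /angular /N2 yx yy; ring.
have rad : radial lambda theta (y x) = expR (g x) ^+ 2 * radial lambda theta (u x).
  by rewrite /radial /N2 yx yy; ring.
have e0 := expR_gt0 (g x).
apply: is_derive_col2.
  under eq_fun do rewrite mxE.
  have d := is_deriveM dE (derive_ux x).
  apply: (is_derive_eq d);
    rewrite [(_ *: f _) _ _]mxE cubic_field_polar_x ang rad yx yy /GRing.scale/= /rho.
  by field; rewrite !gt_eqF.
under eq_fun do rewrite mxE.
have d := is_deriveM dE (derive_uy x).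
apply: (is_derive_eq d);
  rewrite [(_ *: f _) _ _]mxE cubic_field_polar_y ang rad yx yy /GRing.scale/= /rho.
by field; rewrite !gt_eqF.
Qed.

End orbit.

(** The orbit is run through at the angular speed [phi' = h (phi)]. The speed is bounded because
    [lyap] decreases along the orbit, so [phi] exists for all nonnegative times. *)
Lemma exists_solution (z0 : 'cV[R]_2) :
  exists2 z : R -> 'cV[R]_2, solution f z & z 0 = z0.
Proof.
have f_0 : f 0 = 0 by have := cubic_fieldZ lambda theta 0 0;
  rewrite scale0r expr0n/= scale0r.
have [N1z0|N1z0] := ltP 0 (N1 z0); last first.
  have [x0 y0] : z0 ord0 0 = 0 /\ z0 ord_max 0 = 0.
    move: N1z0; rewrite /N1; have := sqr_ge0 (z0 ord0 0).
    have := sqr_ge0 (z0 ord_max 0) => x2 y2 xy2.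
    by split; apply/eqP; rewrite -sqrf_eq0 eq_le ?x2 ?y2 andbT; lra.
  exists (fun=> 0); last by apply: col2P; rewrite mxE ?x0 ?y0.
  split; first by move=> t; exact: cst_continuous.
  by move=> t _; rewrite f_0; exact: is_derive_cst.
have [y [y0 N1y dy]] := exists_orbit_parametrization N1z0.
have [p [q approx]] := rational_approximation lambda_gt0 sin_gt0.
pose h x := angular lambda theta (y x).
have h_gt0 x : 0 < h x by exact: angular_gt0.
have y_cont x : -1 < x -> {for x, continuous y}.
  by move=> x1; have [d _] := dy x x1;
    apply/differentiable_continuous/derivable1_diffP.
have h_cont x : -1 < x -> {for x, continuous h}.
  by move=> x1; apply: continuous_comp;
    [exact: y_cont|exact: continuous_angular].
pose C := (4 * (1 + lambda) * cos theta + lambda * sin theta) *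
          (2 ^+ p.+1 * N1 z0).
have h_le x : 0 <= x -> h x <= C.
  move=> x0; apply: le_trans (angular_le _) _; rewrite ler_wpM2l//.
    by rewrite addr_ge0 ?mulr_ge0 ?addr_ge0 ?(ltW lambda_gt0) ?(ltW cos_gt0) ?(ltW sin_gt0).
  apply: (@N1_le_of_lyap _ p q); rewrite -y0.
  have dL (w : R) : 0 <= w -> exists2 l : R,
      is_derive w (1 : R) (fun x => lyap p q (y x)) l & l <= 0.
    move=> w0; have w1 : -1 < w by lra.
    have k0 : 0 <= (angular lambda theta (y w))^-1 by rewrite invr_ge0 ltW// h_gt0.
    have [l dl l_le] := is_derive_lyap lambda_gt0 cos_gt0 sin_gt0 approx k0 (dy w w1).
    exists l => //; apply: le_trans l_le _;
      rewrite mulr_ge0_le0// !mulNr oppr_le0.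
    by rewrite mulr_ge0 ?lyap_ge0// mulr_ge0 ?N1_ge0// mulr_ge0// ltW.
  apply: (@ler0_derive1_nincry _ (fun x => lyap p q (y x)) 0) => //.
  - by move=> w; rewrite in_itv/= andbT => /ltW/dL[l [dl _] _].
  - move=> w; rewrite in_itv/= andbT => /ltW/dL[l dl l0].
    by rewrite derive1E; case: dl => _ ->.
  - apply: continuous_in_subspaceT => w;
    rewrite inE/= in_itv/= andbT => /dL[l [dl _] _].
    exact/differentiable_continuous/derivable1_diffP.
have [|phi [phi0 phi_ge0 dphi]] := autonomous_ode _ h_cont (fun x _ => h_gt0 x) h_le.
  by lra.
have dz (t : R) : 0 <= t -> is_derive t (1 : R) (y \o phi) (f (y (phi t))).
  move=> t0; have phi1 : -1 < phi t by rewrite (lt_le_trans _ (phi_ge0 t t0)).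
  have di (i : 'I_2) : is_derive t (1 : R) (fun t => y (phi t) i 0) (f (y (phi t)) i 0).
    have d := is_derive1_comp (is_derive_coord i (dy _ phi1)) (dphi t t0).
    apply: (is_derive_eq d); rewrite [(_ *: f _) _ _]mxE mulrAC mulVf ?mul1r//.
    exact: lt0r_neq0 (h_gt0 _).
  by apply: is_derive_col2; exact: di.
exists (y \o phi); last by rewrite /= phi0.
split; last by move=> t /ltW/dz.
apply: continuous_in_subspaceT => t; rewrite inE/= => /dz[d _].
exact/differentiable_continuous/derivable1_diffP.
Qed.

End existence.

(** * Asymptotic stability and choice of the angle *)

Lemma cubic_field_asymptotically_stable (R : realType) (lambda theta : R) :
  0 < lambda -> 0 < sin theta -> sin theta <= cos theta ->
  asymptotically_stable (cubic_field lambda theta).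
Proof.
move=> l0 s0 sc; have c0 := lt_le_trans s0 sc.
have [p [q approx]] := rational_approximation l0 s0.
split.
- by have := cubic_fieldZ lambda theta 0 0; rewrite scale0r expr0n/= scale0r.
- by exists 1 => // z0 _; exact: exists_solution.
- by move=> eps eps0; exact: lyapunov_stable approx _ eps0.
- by exists 1 => // z z_sol _; exact: lyapunov_attractive approx _ z_sol.
Qed.

(** The continuous function [e * cos t - sin t] equals [e > 0] at 0; staying below [pi] keeps the
    sine positive. *)
Lemma exists_small_angle (R : realType) (e bound : R) : 0 < e -> 0 < bound ->
  exists theta : R, [/\ 0 < theta, theta < bound, 0 < sin theta &
    sin theta < e * cos theta].
Proof.
move=> e0 b0.
have : \forall t \near (0 : R), 0 < e * cos t - sin t.
  have c : {for 0, continuous (fun t : R => e * cos t - sin t)}.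
    apply: continuousB; last exact: continuous_sin.
    by apply: continuousM; [exact: cst_continuous|exact: continuous_cos].
  by apply: (cvgr_gt _ c); rewrite cos0 sin0 mulr1 subr0.
case=> r /= r0 H; pose m := Num.min r (Num.min bound pi).
have m0 : 0 < m by rewrite !lt_min r0 b0 pi_gt0.
have t0 : 0 < m / 2 by rewrite divr_gt0.
have tm : m / 2 < m by rewrite ltr_pdivrMr// ltr_pMr// ltr1n.
have [mr mb mpi] : [/\ m <= r, m <= bound & m <= pi].
  by rewrite /m !ge_min !lexx !orbT.
exists (m / 2); split=> //.
- exact: lt_le_trans mb.
- by rewrite sin_gt0_pi// t0 (lt_le_trans tm).
- rewrite -subr_gt0; apply: H.
  by rewrite /ball_/= sub0r normrN gtr0_norm// (lt_le_trans tm).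
Qed.

Theorem mainTheorem2 (R : realType) (lambda : R)
    (lambda_gt0 : 0 < lambda) (lambda_irr : irrational lambda)
    (d : nat) (d_even : ~~ odd d) (bound : R) (bound_gt0 : 0 < bound) :
  exists theta : R,
    [/\ 0 < theta, theta < bound,
        asymptotically_stable (cubic_field lambda theta)
      & ~ exists V : mpoly.mpoly 2 R,
          degree_le V d /\ polynomial_lyapunov (cubic_field lambda theta) V].
Proof.
have [e e0 no_lyap] := no_polynomial_lyapunov d lambda_gt0 lambda_irr.
(* The bound [e] excludes Lyapunov polynomials, and 1 gives the [sin theta <= cos theta] used for
   stability. *)
have e'0 : 0 < Num.min e 1 by rewrite lt_min e0 ltr01.
have [theta [t0 tb s0 sc]] := exists_small_angle e'0 bound_gt0.
have c0 : 0 < cos theta by rewrite -(pmulr_rgt0 _ e'0) (lt_trans s0).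
exists theta; split=> //.
  apply: cubic_field_asymptotically_stable => //.
  by rewrite (le_trans (ltW sc))// ler_piMl ?(ltW c0)// ge_min lexx orbT.
case=> V [Vd lyapV]; apply: (no_lyap theta) Vd lyapV => //; first exact: ltW.
by apply: lt_le_trans sc _; rewrite ler_pM2r// ge_min lexx.
Qed.
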